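(* Over $\mathrm{ACA}_0$, weak Martin's pointed tree theorem $\mathrm{wMPT}$ does not imply $\mathrm{ATR}_0$; that is, $\mathrm{ACA}_0+\mathrm{wMPT}\not\vdash \mathrm{ATR}_0$.
   Context: All theories are in the language of second order arithmetic, with models $(N,M,0,1,+,\times,<)$, where $N$ is the number sort and $M$ is the sort of sets of numbers (equivalently, up to coding, functions from numbers to numbers, called reals). $\mathrm{ACA}_0$ is the usual system including all arithmetical comprehension axioms, and $\mathrm{ATR}_0$ is the usual system of arithmetical transfinite recursion. $\leq_{\rm T}$ denotes Turing reducibility. A tree $T\subseteq\omega^{<\omega}$ is a set of finite strings closed under initial segments; $[T]$ is the collection of its infinite paths. A perfect tree is a nonempty tree in which every node has two incompatible extensions in the tree. A set $A$ of reals is cofinal if for every real $x$ there is some $y\in A$ with $y\geq_{\rm T} x$. Weak Martin's pointed tree theorem, $\mathrm{wMPT}$, is the statement (formulated in second order arithmetic): for every tree $T\subseteq\omega^{<\omega}$, if $[T]$ is cofinal, then $T$ has a perfect subtree. *)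

(* Defs.v *)
From Stdlib Require Import List Arith.
Import ListNotations.

(** * The language of second order arithmetic

    Two sorts of variables (numbers and sets), each with its own de Bruijn
    indices.  Equality is between numbers only: equality of sets is
    coextensionality. *)

Inductive term : Type :=
| tvar (n : nat)
| tzero
| tone
| tadd (s t : term)
| tmul (s t : term).

Inductive form : Type :=
| feq (s t : term)
| flt (s t : term)
| fmem (t : term) (X : nat)
| fbot
| fimp (p q : form)
| fallN (p : form)
| fallS (p : form).

Fixpoint tsubst (sg : nat -> term) (t : term) : term :=
  match t with
  | tvar n => sg n
  | tzero => tzero
  | tone => tone
  | tadd s t => tadd (tsubst sg s) (tsubst sg t)
  | tmul s t => tmul (tsubst sg s) (tsubst sg t)
  end.

Definition tshift (t : term) : term := tsubst (fun n => tvar (S n)) t.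

Definition upN (sg : nat -> term) (n : nat) : term :=
  match n with 0 => tvar 0 | S n => tshift (sg n) end.

Definition upS (r : nat -> nat) (n : nat) : nat :=
  match n with 0 => 0 | S n => S (r n) end.

(** Capture-avoiding simultaneous substitution of terms for number variables
    and of set variables for set variables. *)
Fixpoint subst (sg : nat -> term) (r : nat -> nat) (p : form) : form :=
  match p with
  | feq s t => feq (tsubst sg s) (tsubst sg t)
  | flt s t => flt (tsubst sg s) (tsubst sg t)
  | fmem t X => fmem (tsubst sg t) (r X)
  | fbot => fbot
  | fimp p q => fimp (subst sg r p) (subst sg r q)
  | fallN p => fallN (subst (upN sg) r p)
  | fallS p => fallS (subst sg (upS r) p)
  end.

Definition scons {A : Type} (a : A) (f : nat -> A) (n : nat) : A :=
  match n with 0 => a | S n => f n end.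

Definition shiftN : form -> form := subst (fun n => tvar (S n)) (fun X => X).
Definition shiftS : form -> form := subst tvar S.
Definition instN (t : term) : form -> form := subst (scons t tvar) (fun X => X).
Definition instS (X : nat) : form -> form := subst tvar (scons X (fun Y => Y)).

Fixpoint arithmetical (p : form) : Prop :=
  match p with
  | fimp p q => arithmetical p /\ arithmetical q
  | fallN p => arithmetical p
  | fallS _ => False
  | _ => True
  end.

(** * Provability: classical two-sorted natural deduction with equality

    [prf T G p]: [p] is derivable from the theory [T] and the local hypotheses
    [G].  The formulas in [G] are shifted under a generalization, those in [T]
    are not: an axiom of [T] with free variables (a parameter) stands for its
    universal closure. *)

Inductive prf (T : form -> Prop) : list form -> form -> Prop :=
| prf_ax G p : T p -> prf T G p
| prf_hyp G p : In p G -> prf T G p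
| prf_impI G p q : prf T (p :: G) q -> prf T G (fimp p q)
| prf_impE G p q : prf T G (fimp p q) -> prf T G p -> prf T G q
| prf_raa G p : prf T (fimp p fbot :: G) fbot -> prf T G p
| prf_allNI G p : prf T (map shiftN G) p -> prf T G (fallN p)
| prf_allNE G p t : prf T G (fallN p) -> prf T G (instN t p)
| prf_allSI G p : prf T (map shiftS G) p -> prf T G (fallS p)
| prf_allSE G p X : prf T G (fallS p) -> prf T G (instS X p)
| prf_eq_refl G t : prf T G (feq t t)
| prf_eq_subst G s t p :
    prf T G (feq s t) -> prf T G (instN s p) -> prf T G (instN t p).

Definition provable (T : form -> Prop) (p : form) : Prop := prf T [] p.

(** * Writing formulas with named variables

    An [ntm], [nset] or [fm] is a term, set variable or formula waiting for the
    numbers of number and set quantifiers it stands under.  A quantifier passes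
    to its body its own de Bruijn level, which is turned into an index at each
    place where the variable is used. *)

Definition ntm := nat -> term.
Definition nset := nat -> nat.
Definition fm := nat -> nat -> form.

Definition bzero : ntm := fun _ => tzero.
Definition bone : ntm := fun _ => tone.
Definition badd (s t : ntm) : ntm := fun n => tadd (s n) (t n).
Definition bmul (s t : ntm) : ntm := fun n => tmul (s n) (t n).
Definition beq (s t : ntm) : fm := fun n _ => feq (s n) (t n).
Definition blt (s t : ntm) : fm := fun n _ => flt (s n) (t n).
Definition bmem (t : ntm) (X : nset) : fm := fun n k => fmem (t n) (X k).
Definition bimp (p q : fm) : fm := fun n k => fimp (p n k) (q n k).
Definition bnot (p : fm) : fm := bimp p (fun _ _ => fbot).
Definition band (p q : fm) : fm := bnot (bimp p (bnot q)).
Definition bor (p q : fm) : fm := bimp (bnot p) q.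
Definition biff (p q : fm) : fm := band (bimp p q) (bimp q p).
Definition ballN (F : ntm -> fm) : fm :=
  fun n k => fallN (F (fun n' => tvar (n' - S n)) (S n) k).
Definition ballS (F : nset -> fm) : fm :=
  fun n k => fallS (F (fun k' => k' - S k) n (S k)).
Definition bexN (F : ntm -> fm) : fm := bnot (ballN (fun x => bnot (F x))).
Definition bexS (F : nset -> fm) : fm := bnot (ballS (fun X => bnot (F X))).

(** A de Bruijn formula used as it is, whatever quantifiers it stands under. *)
Definition raw (p : form) : fm := fun _ _ => p.

Declare Scope so_scope.
Delimit Scope so_scope with so.
Bind Scope so_scope with ntm nset fm.

Notation "0" := bzero : so_scope.
Notation "1" := bone : so_scope.
Notation "s + t" := (badd s t) : so_scope.
Notation "s * t" := (bmul s t) : so_scope.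
Notation "s = t" := (beq s t) : so_scope.
Notation "s < t" := (blt s t) : so_scope.
Notation "t ∈ X" := (bmem t X) (at level 70, no associativity) : so_scope.
Notation "~ p" := (bnot p) : so_scope.
Notation "p /\ q" := (band p q) : so_scope.
Notation "p \/ q" := (bor p q) : so_scope.
Notation "p ==> q" := (bimp p q) (at level 99, right associativity) : so_scope.
Notation "p <-> q" := (biff p q) : so_scope.
Notation "'alln' x .. y , p" := (ballN (fun x => .. (ballN (fun y => p%so)) ..))
  (at level 200, x binder, y binder, right associativity) : so_scope.
Notation "'exn' x .. y , p" := (bexN (fun x => .. (bexN (fun y => p%so)) ..))
  (at level 200, x binder, y binder, right associativity) : so_scope.
Notation "'alls' x .. y , p" := (ballS (fun x => .. (ballS (fun y => p%so)) ..))
  (at level 200, x binder, y binder, right associativity) : so_scope.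
Notation "'exs' x .. y , p" := (bexS (fun x => .. (bexS (fun y => p%so)) ..))
  (at level 200, x binder, y binder, right associativity) : so_scope.

Definition sentence (p : fm) : form := p 0 0.
Arguments sentence p%_so.

(** * ACA_0 *)

Definition basic_axioms : list form := [
  sentence (alln m, ~ m + 1 = 0);
  sentence (alln m n, m + 1 = n + 1 ==> m = n);
  sentence (alln m, m + 0 = m);
  sentence (alln m n, m + (n + 1) = (m + n) + 1);
  sentence (alln m, m * 0 = 0);
  sentence (alln m n, m * (n + 1) = (m * n) + m);
  sentence (alln m, ~ m < 0);
  sentence (alln m n, m < n + 1 <-> (m < n \/ m = n)) ].

Definition induction_axiom : form :=
  sentence (alls X,
    (0 ∈ X /\ (alln n, n ∈ X ==> n + 1 ∈ X)) ==> alln n, n ∈ X).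

(** Comprehension for [p]: number variable 0 of [p] is the element, all other
    free variables of [p] are parameters.  The new set is not free in [p]. *)
Definition comprehension (p : form) : form :=
  sentence (exs X, alln n, n ∈ X <-> raw (shiftS p)).

Inductive ACA0 : form -> Prop :=
| ACA0_basic_ax p : In p basic_axioms -> ACA0 p
| ACA0_induction : ACA0 induction_axiom
| ACA0_comprehension p : arithmetical p -> ACA0 (comprehension p).

(** * Pairs, finite strings, reals and trees *)

Section Coding.
Local Open Scope so_scope.

Definition cpair (s t : ntm) : ntm := (s + t) * (s + t) + s.

(** Strings are coded by Goedel's beta function: the code <l,<a,b>> is the
    string of length [l] whose [i]-th entry is the remainder of [a] modulo
    b(i+1)+1. *)
Definition lh (s l : ntm) : fm := exn a b, s = cpair l (cpair a b).

Definition str (s : ntm) : fm := exn l, lh s l.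

Definition ent (s i v : ntm) : fm :=
  exn l a b, s = cpair l (cpair a b) /\ i < l /\
    v < b * (i + 1) + 1 /\ exn q, a = q * (b * (i + 1) + 1) + v.

(** [s] is an initial segment of [t], as strings. *)
Definition pre (s t : ntm) : fm :=
  str s /\ str t /\ alln i v, ent s i v ==> ent t i v.

(** A string has several codes; by closure under initial segments a tree
    contains all of them or none. *)
Definition tree (T : nset) : fm :=
  (alln s, s ∈ T ==> str s) /\
  (alln s t, t ∈ T /\ pre s t ==> s ∈ T).

(** [F] is (the graph of) a function from numbers to numbers, i.e. a real. *)
Definition real (F : nset) : fm :=
  (alln p, p ∈ F ==> exn i v, p = cpair i v) /\
  (alln i, exn v, cpair i v ∈ F /\ alln w, cpair i w ∈ F ==> w = v).

Definition path (F T : nset) : fm :=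
  real F /\
  alln s, str s /\ (alln i v, ent s i v ==> cpair i v ∈ F) ==> s ∈ T.

Definition subtree (P T : nset) : fm := tree P /\ alln s, s ∈ P ==> s ∈ T.

Definition perfect (P : nset) : fm :=
  (exn s, s ∈ P) /\
  (alln s, s ∈ P ==> exn t u, t ∈ P /\ u ∈ P /\ pre s t /\ pre s u /\
                              ~ pre t u /\ ~ pre u t).

(** * Turing reducibility, by oracle register machines

    A program is a string of instructions <o,<r,k>>, where r is a register and
    k a program position:
    - o = 0: increment register r;
    - o = 1: if register r holds 0 go to position k, else decrement it;
    - o = 2: if the number in register r is not in the oracle go to k;
    and the next position is the following one unless stated otherwise.  A
    state is a pair <p,R> of a program position and a string of register
    contents; registers beyond the length of R hold 0. *)

Definition reg (R r v : ntm) : fm :=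
  ent R r v \/ ((exn l, lh R l /\ ~ r < l) /\ v = 0).

Definition update (R r v R' : ntm) : fm :=
  reg R' r v /\ alln q u, ~ q = r ==> (reg R q u <-> reg R' q u).

Definition step (e : ntm) (Y : nset) (c c' : ntm) : fm :=
  exn p R p' R' o r k,
    c = cpair p R /\ c' = cpair p' R' /\ ent e p (cpair o (cpair r k)) /\
    ( (o = 0 /\ p' = p + 1 /\ exn v, reg R r v /\ update R r (v + 1) R')
   \/ (o = 1 /\ ( (reg R r 0 /\ R' = R /\ p' = k)
               \/ (p' = p + 1 /\ exn v, reg R r (v + 1) /\ update R r v R')))
   \/ (o = 1 + 1 /\ R' = R /\
       exn v, reg R r v /\ ((v ∈ Y /\ p' = p + 1) \/ (~ v ∈ Y /\ p' = k)))).

(** Program [e] with oracle [Y], started with [n] in register 0 and 0 in all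
    others, halts (by reaching the position just after its last instruction)
    with [v] in register 0; [c] is the string of the t+1 states it goes through. *)
Definition computes (e : ntm) (Y : nset) (n v : ntm) : fm :=
  exn c t, lh c (t + 1) /\
    (exn R, ent c 0 (cpair 0 R) /\ reg R 0 n /\
       alln r, ~ r = 0 ==> reg R r 0) /\
    (alln i, i < t ==> exn x y, ent c i x /\ ent c (i + 1) y /\ step e Y x y) /\
    (exn p R, ent c t (cpair p R) /\ lh e p /\ reg R 0 v).

Definition turing_le (X Y : nset) : fm :=
  exn e, alln n,
    (n ∈ X ==> computes e Y n 1) /\ (~ n ∈ X ==> computes e Y n 0).

(** * Weak Martin's pointed tree theorem *)

Definition cofinal_paths (T : nset) : fm :=
  alls X, real X ==> exs Y, path Y T /\ turing_le X Y.

Definition wMPT : form :=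
  sentence (alls T, tree T /\ cofinal_paths T ==>
              exs P, subtree P T /\ perfect P).

(** * ATR_0 *)

(** A set [X] codes the relation i <=_X j iff <i,j> is in [X], with field the
    set of i such that i <=_X i. *)
Definition le_in (X : nset) (i j : ntm) : fm := cpair i j ∈ X.
Definition lt_in (X : nset) (i j : ntm) : fm := le_in X i j /\ ~ le_in X j i.

Definition linear_order (X : nset) : fm :=
  (alln i j, le_in X i j ==> le_in X i i /\ le_in X j j) /\
  (alln i j k, le_in X i j /\ le_in X j k ==> le_in X i k) /\
  (alln i j, le_in X i j /\ le_in X j i ==> i = j) /\
  (alln i j, le_in X i i /\ le_in X j j ==> le_in X i j \/ le_in X j i).

Definition well_founded_order (X : nset) : fm :=
  ~ exs F, real F /\
      alln n, exn u v, cpair n u ∈ F /\ cpair (n + 1) v ∈ F /\ lt_in X v u.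

Definition well_order (X : nset) : fm :=
  linear_order X /\ well_founded_order X.

(** Z = Y^j = {<m,i> in Y : i <_X j} *)
Definition below (X Y : nset) (j : ntm) (Z : nset) : fm :=
  alln q, q ∈ Z <-> exn m i, q = cpair m i /\ lt_in X i j /\ q ∈ Y.

Definition shift_params : form -> form :=
  subst (scons (tvar O) (fun k => tvar (S (S (S k)))))
        (scons O (fun k => S (S (S k)))).

(** Transfinite recursion for [th]: for every well order X there is
    Y = {<n,j> : j in the field of X and th(n, Y^j)}.  In [th] number variable 0
    is n and set variable 0 is Y^j (that is, Z); the other free variables are
    parameters, moved by [shift_params] past p, j and X, Y respectively. *)
Definition transfinite_recursion (th : form) : form :=
  sentence (alls X, well_order X ==> exs Y,
    alln p, p ∈ Y <->
      exn j n, p = cpair n j /\ le_in X j j /\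
        exs Z, below X Y j Z /\
          raw (shift_params th)).

Inductive ATR0 : form -> Prop :=
| ATR0_ACA0 p : ACA0 p -> ATR0 p
| ATR0_rec th : arithmetical th -> ATR0 (transfinite_recursion th).

End Coding.

(** [T] proves every axiom of [U]. *)
Definition proves_theory (T U : form -> Prop) : Prop :=
  forall p, U p -> provable T p.

Definition add_axiom (T : form -> Prop) (p : form) : form -> Prop :=
  fun q => T q \/ q = p.

(* Main.v *)
From Stdlib Require Import List Arith Lia Factorial Classical ClassicalEpsilon
  FunctionalExtensionality PropExtensionality.
Require Import Defs.

(** Let K_0 be the class of sets arithmetical in a fixed set W, let K_{i+1} = K_i[g_i] be
    the arithmetical closure of K_i and a Cohen real g_i generic over K_i, and let M be the
    union of the K_i.  Each K_i, hence M, is closed under arithmetical comprehension; so M,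
    with the standard numbers, is a model of ACA_0.

    If T is a tree in K_i whose paths are cofinal in M, some path computes a real outside
    K_i, so some path Y lies in K_{j+1} but not in K_j with j >= i.  Below a suitable
    condition p, the strings that some q <= p forces to be initial segments of Y form a
    subtree of T in K_j, and it is perfect because no q <= p decides all of Y.

    On the other hand, transfinite recursion along the order of the natural numbers yields a
    truth predicate for the sets in K_0, hence a set that diagonalizes against K_0; the
    generics are chosen so that this set stays outside every K_i. *)

(** * Pairing *)

(** The value is at least (s+t)^2 and below (s+t+1)^2, so the integer square root recovers s + t and
    decoding is explicit. *)
Definition pr (s t : nat) : nat := (s + t) * (s + t) + s.
Definition pi1 (n : nat) : nat := n - Nat.sqrt n * Nat.sqrt n.
Definition pi2 (n : nat) : nat := Nat.sqrt n - pi1 n.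

Lemma sqrt_pr s t : Nat.sqrt (pr s t) = s + t.
Proof. apply Nat.sqrt_unique; unfold pr; nia. Qed.

Lemma pi1_pr s t : pi1 (pr s t) = s.
Proof. unfold pi1; rewrite sqrt_pr; unfold pr; lia. Qed.

Lemma pi2_pr s t : pi2 (pr s t) = t.
Proof. unfold pi2; rewrite sqrt_pr, pi1_pr; lia. Qed.

Lemma pr_inj a b c d : pr a b = pr c d -> a = c /\ b = d.
Proof.
  intros E; split.
  - now rewrite <- (pi1_pr a b), E, pi1_pr.
  - now rewrite <- (pi2_pr a b), E, pi2_pr.
Qed.

Lemma pr_gt_r a b : 0 < a -> b < pr a b.
Proof. unfold pr; nia. Qed.

Lemma pr_ge_l a b : a <= pr a b.
Proof. unfold pr; nia. Qed.

Lemma pr_ge_r a b : b <= pr a b.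
Proof. unfold pr; nia. Qed.

Global Opaque pi1 pi2.
Hint Rewrite pi1_pr pi2_pr : pr.

(** * Models with standard numbers *)

Fixpoint eval (rho : nat -> nat) (t : term) : nat :=
  match t with
  | tvar n => rho n
  | tzero => 0
  | tone => 1
  | tadd s t => eval rho s + eval rho t
  | tmul s t => eval rho s * eval rho t
  end.

(** A single number carries a whole assignment, so a formula with number parameters defines a set of
    numbers, and a quantifier prepends one component. *)
Definition env (e i : nat) : nat := pi1 (Nat.iter i pi2 e).

Lemma env_pr x e : env (pr x e) = scons x (env e).
Proof.
  apply functional_extensionality; intros [|i]; unfold env.
  - apply pi1_pr.
  - cbn [scons]. rewrite Nat.iter_succ_r, pi2_pr. reflexivity.
Qed.

Section Satisfaction.
Variable M : (nat -> Prop) -> Prop.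

Fixpoint sat (rho : nat -> nat) (sigma : nat -> nat -> Prop) (p : form) : Prop :=
  match p with
  | feq s t => eval rho s = eval rho t
  | flt s t => eval rho s < eval rho t
  | fmem t X => sigma X (eval rho t)
  | fbot => False
  | fimp p q => sat rho sigma p -> sat rho sigma q
  | fallN p => forall x, sat (scons x rho) sigma p
  | fallS p => forall X, M X -> sat rho (scons X sigma) p
  end.

Lemma eval_tsubst rho sg t :
  eval rho (tsubst sg t) = eval (fun n => eval rho (sg n)) t.
Proof. induction t; cbn; congruence. Qed.

Lemma sat_subst p : forall rho sigma sg r,
  sat rho sigma (subst sg r p)
  <-> sat (fun n => eval rho (sg n)) (fun X => sigma (r X)) p.
Proof.
  induction p; intros rho sigma sg r; cbn; rewrite ?eval_tsubst; try tauto.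
  - rewrite IHp1, IHp2; tauto.
  - enough (forall x, (fun n => eval (scons x rho) (upN sg n))
                      = scons x (fun n => eval rho (sg n))) as E
      by (split; intros H x; specialize (H x); rewrite ?IHp, ?E in *; exact H).
    intros x; apply functional_extensionality; intros [|n]; cbn; [reflexivity|].
    unfold tshift; now rewrite eval_tsubst.
  - enough (forall X, (fun n => scons X sigma (upS r n))
                      = scons X (fun n => sigma (r n))) as E
      by (split; intros H x Hx; specialize (H x Hx); rewrite ?IHp, ?E in *; exact H).
    intros X; apply functional_extensionality; intros [|n]; reflexivity.
Qed.

Lemma sat_shiftN x rho sigma p : sat (scons x rho) sigma (shiftN p) <-> sat rho sigma p.
Proof. unfold shiftN; rewrite sat_subst; reflexivity. Qed.

Lemma sat_shiftS X rho sigma p : sat rho (scons X sigma) (shiftS p) <-> sat rho sigma p.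
Proof. unfold shiftS; rewrite sat_subst; reflexivity. Qed.

Lemma sat_instN t rho sigma p :
  sat rho sigma (instN t p) <-> sat (scons (eval rho t) rho) sigma p.
Proof.
  unfold instN; rewrite sat_subst.
  enough ((fun n => eval rho (scons t tvar n)) = scons (eval rho t) rho) as -> by tauto.
  apply functional_extensionality; intros [|n]; reflexivity.
Qed.

Lemma sat_instS X rho sigma p :
  sat rho sigma (instS X p) <-> sat rho (scons (sigma X) sigma) p.
Proof.
  unfold instS; rewrite sat_subst.
  enough ((fun Y => sigma (scons X (fun Y => Y) Y)) = scons (sigma X) sigma) as -> by tauto.
  apply functional_extensionality; intros [|n]; reflexivity.
Qed.

(* Number assignments are restricted to those of the form [env e]: an axiom with
   parameters is then about finitely many numbers, coded by [e]. *)
Definition valid (p : form) : Prop :=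
  forall e sigma, (forall X, M (sigma X)) -> sat (env e) sigma p.

Lemma soundness (T : form -> Prop) (HT : forall p, T p -> valid p) G p :
  prf T G p -> forall e sigma, (forall X, M (sigma X)) ->
  (forall q, In q G -> sat (env e) sigma q) -> sat (env e) sigma p.
Proof.
  induction 1 as [G p H|G p H|G p q _ IH|G p q _ IH1 _ IH2|G p _ IH|G p _ IH
    |G p t _ IH|G p _ IH|G p X _ IH|G t|G s t p _ IH1 _ IH2];
    intros e sigma Hs HG.
  - now apply HT.
  - now apply HG.
  - intros Hp. apply IH; [assumption|]. intros r [<-|Hr]; auto.
  - apply (IH1 e sigma Hs HG), (IH2 e sigma Hs HG).
  - apply NNPP; intros Hn. apply (IH e sigma Hs). intros r [<-|Hr]; auto.
  - intros x. rewrite <- env_pr. apply IH; [assumption|].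
    intros q Hq; apply in_map_iff in Hq as (r & <- & Hr).
    rewrite env_pr; apply sat_shiftN; auto.
  - apply sat_instN, (IH e sigma Hs HG).
  - intros X HX. apply IH; [intros [|Y]; cbn; auto|].
    intros q Hq; apply in_map_iff in Hq as (r & <- & Hr). apply sat_shiftS; auto.
  - apply sat_instS, (IH e sigma Hs HG), Hs.
  - reflexivity.
  - apply sat_instN. specialize (IH1 e sigma Hs HG); cbn in IH1.
    rewrite <- IH1. apply sat_instN. auto.
Qed.

Lemma soundness_provable (T : form -> Prop) (HT : forall p, T p -> valid p) p :
  provable T p -> valid p.
Proof. intros H e sigma Hs. eapply soundness; eauto. intros q []. Qed.

End Satisfaction.

Definition exM (M : (nat -> Prop) -> Prop) (P : (nat -> Prop) -> Prop) : Prop :=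
  exists X, M X /\ P X.

Lemma and_encoded : and = fun P Q => (P -> (Q -> False)) -> False.
Proof.
  apply functional_extensionality; intros P; apply functional_extensionality; intros Q.
  apply propositional_extensionality; tauto.
Qed.

Lemma or_encoded : or = fun P Q => (P -> False) -> Q.
Proof.
  apply functional_extensionality; intros P; apply functional_extensionality; intros Q.
  apply propositional_extensionality; tauto.
Qed.

Lemma ex_encoded : @ex nat = fun P => (forall x, P x -> False) -> False.
Proof.
  apply functional_extensionality; intros P. apply propositional_extensionality; split.
  - intros [x Hx] H; eauto.
  - intros H; apply NNPP; intros Hn; apply H; intros x Hx; eauto.
Qed.

Lemma exM_encoded : exM = fun M P => (forall X, M X -> P X -> False) -> False.
Proof.
  apply functional_extensionality; intros M; apply functional_extensionality; intros P.
  apply propositional_extensionality; split.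
  - intros (x & H1 & H2) H; eauto.
  - intros H; apply NNPP; intros Hn; apply H; intros x Hx; unfold exM in *; eauto.
Qed.

(* The named-variable layer encodes the connectives by implication and falsity.  As closed
   constants, [and], [or], [ex] and [exM] can be replaced by their encodings even under
   binders; the meaning of a concrete sentence then is [sat] up to conversion. *)
Ltac sat_meaning :=
  rewrite ?and_encoded, ?or_encoded, ?exM_encoded, ?ex_encoded; exact (fun H => H).

(** * Codes of functions and of definitions, and the oracle *)

Definition Lh (s l : nat) : Prop := exists a b, s = pr l (pr a b).
Definition Str (s : nat) : Prop := exists l, Lh s l.
Definition Ent (s i v : nat) : Prop :=
  exists l a b, s = pr l (pr a b) /\ i < l /\ v < b * (i + 1) + 1 /\
    exists q, a = q * (b * (i + 1) + 1) + v.

(** Enough functions to rearrange the components of coded tuples and to evaluate terms; having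
    codes, they can occur inside the coded definitions [sx]. *)
Inductive fn : Type :=
| Fid
| Fconst (c : nat)
| Fpi1 (f : fn)
| Fpi2 (f : fn)
| Fpr (f g : fn)
| Fadd (f g : fn)
| Fmul (f g : fn).

Fixpoint fapp (f : fn) (x : nat) : nat :=
  match f with
  | Fid => x
  | Fconst c => c
  | Fpi1 f => pi1 (fapp f x)
  | Fpi2 f => pi2 (fapp f x)
  | Fpr f g => pr (fapp f x) (fapp g x)
  | Fadd f g => fapp f x + fapp g x
  | Fmul f g => fapp f x * fapp g x
  end.

Fixpoint fn_code (f : fn) : nat :=
  match f with
  | Fid => pr 0 0
  | Fconst c => pr 1 c
  | Fpi1 f => pr 2 (fn_code f)
  | Fpi2 f => pr 3 (fn_code f)
  | Fpr f g => pr 4 (pr (fn_code f) (fn_code g))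
  | Fadd f g => pr 5 (pr (fn_code f) (fn_code g))
  | Fmul f g => pr 6 (pr (fn_code f) (fn_code g))
  end.

Lemma fn_code_inj f : forall g, fn_code f = fn_code g -> f = g.
Proof.
  induction f as [|c|f IHf|f IHf|f IHf f' IHf'|f IHf f' IHf'|f IHf f' IHf'];
    intros [] E; apply pr_inj in E as [E1 E2]; try discriminate; try (f_equal; auto; fail);
    try reflexivity.
  all: apply pr_inj in E2 as [E2 E3]; f_equal; auto.
Qed.

(** Syntax of the arithmetical definitions over [W], interpreted by [den]; the variable bound by
    [SAll] is the first component of the argument. *)
Inductive sx : Type :=
| SBase
| SPre (f : fn) (a : sx)
| SImp (a b : sx)
| SAll (a : sx).

(** The tags start at 1 so that, by [pr_gt_r], a code exceeds the codes of its immediate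
    subdefinitions; the recursion behind [column_truth] runs along these codes. *)
Fixpoint sx_code (x : sx) : nat :=
  match x with
  | SBase => pr 1 0
  | SPre f a => pr 2 (pr (fn_code f) (sx_code a))
  | SImp a b => pr 3 (pr (sx_code a) (sx_code b))
  | SAll a => pr 4 (sx_code a)
  end.

Lemma sx_code_inj x : forall y, sx_code x = sx_code y -> x = y.
Proof.
  induction x as [|f a IHa|a IHa b IHb|a IHa]; intros [] E;
    apply pr_inj in E as [E1 E2]; try discriminate; try reflexivity.
  - apply pr_inj in E2 as [E2 E3]. apply fn_code_inj in E2. f_equal; auto.
  - apply pr_inj in E2 as [E2 E3]; f_equal; auto.
  - f_equal; auto.
Qed.

(** A Cohen condition [<a,m>] stands for the binary string of the first [m] bits
    of [a]; [extends q p] says that [q] is the stronger condition. *)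
Definition extends (q p : nat) : Prop :=
  pi2 p <= pi2 q /\ forall i, i < pi2 p -> Nat.testbit (pi1 q) i = Nat.testbit (pi1 p) i.

(* Everything whose arithmetical definability would otherwise have to be proved
   from + and * alone is put into this one oracle. *)
Inductive W : nat -> Prop :=
| W_sx x : W (pr 0 (sx_code x))
| W_fn f x : W (pr 1 (pr (fn_code f) (pr x (fapp f x))))
| W_eq x : W (pr 2 (pr x x))
| W_lt x y : x < y -> W (pr 3 (pr x y))
| W_ext p q : extends q p -> W (pr 4 (pr q p))
| W_ent s i v : Ent s i v -> W (pr 5 (pr s (pr i v)))
| W_str s : Str s -> W (pr 6 s).

Ltac W_inv :=
  match goal with H : W ?t |- _ => remember t as z eqn:E; destruct H end;
  repeat match goal with E : pr _ _ = pr _ _ |- _ => apply pr_inj in E as [? ?] end;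
  try discriminate.

Lemma W_sxE j : W (pr 0 j) <-> exists x, sx_code x = j.
Proof. split; [intros H; W_inv; subst; eauto|intros (x & <-); constructor]. Qed.
Lemma W_fnE f x y : W (pr 1 (pr (fn_code f) (pr x y))) <-> fapp f x = y.
Proof.
  split; [|intros <-; constructor].
  intros H; W_inv.
  match goal with E : fn_code _ = fn_code _ |- _ => apply fn_code_inj in E end. now subst.
Qed.
Lemma W_eqE x y : W (pr 2 (pr x y)) <-> x = y.
Proof. split; [intros H; W_inv; congruence|intros <-; constructor]. Qed.
Lemma W_ltE x y : W (pr 3 (pr x y)) <-> x < y.
Proof. split; [intros H; W_inv; subst; auto|now constructor]. Qed.
Lemma W_extE q p : W (pr 4 (pr q p)) <-> extends q p.
Proof. split; [intros H; W_inv; subst; auto|now constructor]. Qed.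
Lemma W_entE s i v : W (pr 5 (pr s (pr i v))) <-> Ent s i v.
Proof. split; [intros H; W_inv; subst; auto|now constructor]. Qed.
Lemma W_strE s : W (pr 6 s) <-> Str s.
Proof. split; [intros H; W_inv; subst; auto|now constructor]. Qed.

(** * Classes of sets closed under arithmetical definability *)

Definition is_fn (g : nat -> nat) : Prop := exists f, forall x, fapp f x = g x.

(** Sets of single numbers suffice for arithmetical closure: parameters and bound variables are
    components of a pair, and [cl_pre] rearranges them. *)
Record closed_class := {
  cl :> (nat -> Prop) -> Prop;
  cl_base : cl W;
  cl_pre A f : cl A -> cl (fun e => A (fapp f e));
  cl_imp A B : cl A -> cl B -> cl (fun e => A e -> B e);
  cl_all A : cl A -> cl (fun e => forall x, A (pr x e)) }.

Lemma is_fn_id : is_fn (fun e => e).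
Proof. now exists Fid. Qed.
Lemma is_fn_const c : is_fn (fun _ => c).
Proof. now exists (Fconst c). Qed.
Lemma is_fn_pi1 f : is_fn f -> is_fn (fun e => pi1 (f e)).
Proof. intros [a Ha]. exists (Fpi1 a). intros x; cbn; now rewrite Ha. Qed.
Lemma is_fn_pi2 f : is_fn f -> is_fn (fun e => pi2 (f e)).
Proof. intros [a Ha]. exists (Fpi2 a). intros x; cbn; now rewrite Ha. Qed.
Lemma is_fn_pr f g : is_fn f -> is_fn g -> is_fn (fun e => pr (f e) (g e)).
Proof. intros [a Ha] [b Hb]. exists (Fpr a b). intros x; cbn; now rewrite Ha, Hb. Qed.
Lemma is_fn_add f g : is_fn f -> is_fn g -> is_fn (fun e => f e + g e).
Proof. intros [a Ha] [b Hb]. exists (Fadd a b). intros x; cbn; now rewrite Ha, Hb. Qed.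
Lemma is_fn_mul f g : is_fn f -> is_fn g -> is_fn (fun e => f e * g e).
Proof. intros [a Ha] [b Hb]. exists (Fmul a b). intros x; cbn; now rewrite Ha, Hb. Qed.
Lemma is_fn_S f : is_fn f -> is_fn (fun e => S (f e)).
Proof.
  intros [a Ha]. exists (Fadd (Fconst 1) a). intros x; cbn; now rewrite Ha.
Qed.

Fixpoint fn_comp (f g : fn) : fn :=
  match f with
  | Fid => g
  | Fconst c => Fconst c
  | Fpi1 f => Fpi1 (fn_comp f g)
  | Fpi2 f => Fpi2 (fn_comp f g)
  | Fpr f f' => Fpr (fn_comp f g) (fn_comp f' g)
  | Fadd f f' => Fadd (fn_comp f g) (fn_comp f' g)
  | Fmul f f' => Fmul (fn_comp f g) (fn_comp f' g)
  end.

Lemma is_fn_comp f g : is_fn f -> is_fn g -> is_fn (fun e => f (g e)).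
Proof.
  intros [a Ha] [b Hb]. exists (fn_comp a b). intros x. rewrite <- Ha, <- Hb.
  clear Ha. induction a; cbn; congruence.
Qed.

Lemma is_fn_fapp f : is_fn (fapp f).
Proof. now exists f. Qed.

Ltac is_fn :=
  repeat first [ assumption | apply is_fn_fapp
               | match goal with
                 | H : is_fn ?f |- is_fn (fun e => ?f (@?g e)) => apply (is_fn_comp f g H)
                 | |- is_fn (fun e => fapp ?f (@?g e)) =>
                     apply (is_fn_comp (fapp f) g (is_fn_fapp f))
                 end
               | apply is_fn_id | apply is_fn_const | apply is_fn_pr
               | apply is_fn_pi1 | apply is_fn_pi2 | apply is_fn_S
               | apply is_fn_add | apply is_fn_mul ].

Section Definability.
Variable C : closed_class.

Lemma def_ext A B : (forall e, A e <-> B e) -> C A -> C B.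
Proof.
  intros H HA. replace B with A; [assumption|].
  apply functional_extensionality; intros e. now apply propositional_extensionality.
Qed.

Lemma def_pre A f : C A -> is_fn f -> C (fun e => A (f e)).
Proof.
  intros HA [g Hg]. apply (def_ext (fun e => A (fapp g e))); [intros e; now rewrite Hg|].
  now apply cl_pre.
Qed.

Lemma def_base f : is_fn f -> C (fun e => W (f e)).
Proof. apply def_pre, cl_base. Qed.

Lemma def_imp A B : C A -> C B -> C (fun e => A e -> B e).
Proof. apply cl_imp. Qed.

Lemma def_all (P : nat -> nat -> Prop) :
  C (fun z => P (pi1 z) (pi2 z)) -> C (fun e => forall x, P x e).
Proof.
  intros H; apply cl_all in H. revert H; apply def_ext; intros e.
  split; intros H x; specialize (H x); autorewrite with pr in *; assumption.
Qed.

Lemma def_eq f g : is_fn f -> is_fn g -> C (fun e => f e = g e).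
Proof.
  intros Hf Hg. apply (def_ext (fun e => W (pr 2 (pr (f e) (g e))))).
  - intros e; apply W_eqE.
  - apply def_base; is_fn.
Qed.

Lemma def_lt f g : is_fn f -> is_fn g -> C (fun e => f e < g e).
Proof.
  intros Hf Hg. apply (def_ext (fun e => W (pr 3 (pr (f e) (g e))))).
  - intros e; apply W_ltE.
  - apply def_base; is_fn.
Qed.

Lemma def_extends f g : is_fn f -> is_fn g -> C (fun e => extends (f e) (g e)).
Proof.
  intros Hf Hg. apply (def_ext (fun e => W (pr 4 (pr (f e) (g e))))).
  - intros e; apply W_extE.
  - apply def_base; is_fn.
Qed.

Lemma def_Ent f g h : is_fn f -> is_fn g -> is_fn h -> C (fun e => Ent (f e) (g e) (h e)).
Proof.
  intros Hf Hg Hh. apply (def_ext (fun e => W (pr 5 (pr (f e) (pr (g e) (h e)))))).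
  - intros e; apply W_entE.
  - apply def_base; is_fn.
Qed.

Lemma def_Str f : is_fn f -> C (fun e => Str (f e)).
Proof.
  intros Hf. apply (def_ext (fun e => W (pr 6 (f e)))).
  - intros e; apply W_strE.
  - apply def_base; is_fn.
Qed.

Lemma def_False : C (fun _ => False).
Proof.
  apply (def_ext (fun e => 0 = 1)); [intros e; lia|]. apply def_eq; is_fn.
Qed.

Lemma def_not A : C A -> C (fun e => ~ A e).
Proof. intros H; apply def_imp; [assumption|apply def_False]. Qed.

Lemma def_and A B : C A -> C B -> C (fun e => A e /\ B e).
Proof.
  intros HA HB. apply (def_ext (fun e => ~ (A e -> ~ B e))); [intros e; tauto|].
  apply def_not, def_imp, def_not; assumption.
Qed.

Lemma def_or A B : C A -> C B -> C (fun e => A e \/ B e).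
Proof.
  intros HA HB. apply (def_ext (fun e => ~ A e -> B e)); [intros e; tauto|].
  apply def_imp; [apply def_not|]; assumption.
Qed.

Lemma def_iff A B : C A -> C B -> C (fun e => A e <-> B e).
Proof. intros; apply def_and; apply def_imp; assumption. Qed.

Lemma def_ex (P : nat -> nat -> Prop) :
  C (fun z => P (pi1 z) (pi2 z)) -> C (fun e => exists x, P x e).
Proof.
  intros H. apply (def_ext (fun e => ~ forall x, ~ P x e)).
  - intros e; split; [intros Hn; apply NNPP; intros He; apply Hn; eauto|firstorder].
  - apply def_not, (def_all (fun x e => ~ P x e)), def_not, H.
Qed.

End Definability.

(** Follows the shape of the definition; goals that match no closure lemma, such as those about
    [forces], are left to the caller. *)
Ltac definable :=
  lazymatch goal with
  | |- is_fn _ => is_fn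
  | |- cl ?C (fun e => forall x : nat, @?P e x) =>
      apply (def_all C (fun x e => P e x)); cbv beta; definable
  | |- cl ?C (fun e => exists x : nat, @?P e x) =>
      apply (def_ex C (fun x e => P e x)); cbv beta; definable
  | |- cl _ (fun e => _ /\ _) => apply def_and; definable
  | |- cl _ (fun e => _ \/ _) => apply def_or; definable
  | |- cl _ (fun e => _ <-> _) => apply def_iff; definable
  | |- cl _ (fun e => ~ _) => apply def_not; definable
  | |- cl _ (fun e => _ -> _) => apply def_imp; definable
  | |- cl _ (fun e => False) => apply def_False
  | |- cl _ (fun e => _ = _ :> nat) => apply def_eq; is_fn
  | |- cl _ (fun e => _ < _) => apply def_lt; is_fn
  | |- cl _ (fun e => extends _ _) => apply def_extends; is_fn
  | |- cl _ (fun e => Ent _ _ _) => apply def_Ent; is_fn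
  | |- cl _ (fun e => Str _) => apply def_Str; is_fn
  | |- cl ?C Str => apply (def_Str C (fun e => e)); is_fn
  | |- cl ?C (fun e => W _) => apply def_base; is_fn
  | |- cl ?C (fun e => ?A (@?f e)) => try (apply (def_pre C A f); [try assumption | is_fn])
  | |- _ => try assumption
  end.

Lemma is_fn_eval t : is_fn (fun e => eval (env e) t).
Proof.
  induction t as [n| | | |]; cbn; is_fn. unfold env.
  induction n as [|n IH]; cbn; is_fn.
Qed.

Section Comprehension.
Variables (C : closed_class) (M : (nat -> Prop) -> Prop).

(** Each formula constructor matches a closure property: terms are functions in the sense of
    [is_fn], and [env_pr] turns [fallN] into [cl_all]. *)
Lemma arithmetical_closed sigma p : arithmetical p -> (forall X, C (sigma X)) ->
  C (fun e => sat M (env e) sigma p).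
Proof.
  intros Hp Hs. induction p as [s t|s t|t X| |p IHp q IHq|p IHp|p IHp]; cbn in *.
  - apply def_eq; apply is_fn_eval.
  - apply def_lt; apply is_fn_eval.
  - apply (def_pre C (sigma X)); [apply Hs|apply is_fn_eval].
  - apply def_False.
  - apply def_imp; tauto.
  - specialize (IHp Hp). apply cl_all in IHp. revert IHp; apply def_ext; intros e.
    split; intros H x; specialize (H x); rewrite env_pr in *; assumption.
  - destruct Hp.
Qed.

Lemma arithmetical_comprehension e sigma p : arithmetical p -> (forall X, C (sigma X)) ->
  C (fun n => sat M (scons n (env e)) sigma p).
Proof.
  intros Hp Hs. apply (def_ext C (fun n => sat M (env (pr n e)) sigma p)).
  - intros n; now rewrite env_pr.
  - apply (def_pre C (fun e => sat M (env e) sigma p)); [now apply arithmetical_closed|is_fn].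
Qed.
End Comprehension.

Lemma ACA0_valid (C : closed_class) p : ACA0 p -> valid C p.
Proof.
  intros H e sigma Hs. destruct H as [p H| |p Hp].
  - cbn in H. repeat destruct H as [<-|H]; try contradiction; cbn; intros; try lia.
  - enough (forall X, C X -> X 0 /\ (forall n, X n -> X (n + 1)) -> forall n, X n) as H
      by (revert H; sat_meaning).
    intros X _ [H0 HS] n. induction n as [|n IH]; [assumption|].
    replace (S n) with (n + 1) by lia. now apply HS.
  - set (X := fun n => sat C (scons n (env e)) sigma p).
    enough (exM C (fun X => forall n, X n <-> sat C (scons n (env e)) (scons X sigma) (shiftS p)))
      as H by (revert H; unfold iff; sat_meaning).
    exists X. split; [apply arithmetical_comprehension; auto|].
    intros n; now rewrite sat_shiftS.
Qed.

(** * Cohen conditions, dense sets and filters *)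

Lemma extends_refl p : extends p p.
Proof. split; auto. Qed.

Lemma extends_trans r q p : extends r q -> extends q p -> extends r p.
Proof.
  intros [H1 H2] [H3 H4]; split; [lia|].
  intros i Hi. rewrite H2 by lia. now apply H4.
Qed.

Definition compatible (p q : nat) : Prop := exists r, extends r p /\ extends r q.

Lemma incompatible_extensions p :
  exists q r, extends q p /\ extends r p /\ ~ compatible q r.
Proof.
  (* Lengthen [p] by one bit, once by 1 and once by 0. *)
  exists (pr (Nat.setbit (pi1 p) (pi2 p)) (S (pi2 p))),
         (pr (Nat.clearbit (pi1 p) (pi2 p)) (S (pi2 p))).
  unfold compatible, extends. rewrite !pi1_pr, !pi2_pr.
  split; [|split].
  - split; [lia|]. intros i Hi. apply Nat.setbit_neq. lia.
  - split; [lia|]. intros i Hi. apply Nat.clearbit_neq. lia.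
  - intros (r & [_ H1] & [_ H2]). specialize (H1 (pi2 p)); specialize (H2 (pi2 p)).
    rewrite Nat.setbit_eq in H1; rewrite Nat.clearbit_eq in H2.
    rewrite H1 in H2 by lia. specialize (H2 (Nat.lt_succ_diag_r _)). discriminate.
Qed.

Definition dense (D : nat -> Prop) : Prop := forall p, exists q, extends q p /\ D q.

Record filter (g : nat -> Prop) : Prop := {
  filter_inhabited : exists p, g p;
  filter_up p q : g q -> extends q p -> g p;
  filter_directed p q : g p -> g q -> exists r, g r /\ extends r p /\ extends r q }.

(** The Rasiowa-Sikorski construction: a descending sequence whose step from i to i + 1 enters
    [D i], closed upwards. *)
Lemma filter_meeting (D : nat -> nat -> Prop) : (forall i, dense (D i)) ->
  exists g, filter g /\ forall i, exists p, g p /\ D i p.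
Proof.
  intros HD.
  pose (next i p := proj1_sig (constructive_indefinite_description _ (HD i p))).
  assert (Hnext : forall i p, extends (next i p) p /\ D i (next i p))
    by (intros i p; apply proj2_sig).
  pose (s := fix s i := match i with 0 => 0 | S i => next i (s i) end).
  assert (Hs : forall i j, i <= j -> extends (s j) (s i)).
  { induction 1 as [|j _ IH]; [apply extends_refl|].
    eapply extends_trans; [apply (Hnext j)|exact IH]. }
  exists (fun p => exists i, extends (s i) p). split; [split|].
  - exists (s 0), 0. apply extends_refl.
  - intros p q [i Hi] H. exists i. eapply extends_trans; eauto.
  - intros p q [i Hi] [j Hj]. exists (s (max i j)). split; [exists (max i j); apply extends_refl|].
    split; (eapply extends_trans; [apply Hs|eassumption]); lia.
  - intros i. exists (s (S i)). split; [exists (S i); apply extends_refl|apply (Hnext i)].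
Qed.

(** * Generic extensions *)

(** A set [F] is read as a name: [<p,n>] in [F] means that [p] puts [n] into the set. *)
Definition forces (F : nat -> Prop) (q n : nat) : Prop :=
  exists p, extends q p /\ F (pr p n).

Definition value (g F : nat -> Prop) (n : nat) : Prop :=
  exists p, g p /\ forces F p n.

Lemma forces_mono F q r n : extends r q -> forces F q n -> forces F r n.
Proof. intros H (p & Hp & HF). exists p; split; [eapply extends_trans; eauto|assumption]. Qed.

Lemma def_forces (C : closed_class) F f h : C F -> is_fn f -> is_fn h ->
  C (fun e => forces F (f e) (h e)).
Proof. intros HF Hf Hh. unfold forces. definable. Qed.

(** Genericity over a class is stated as meeting [decides D] for each [D] in it; these sets are
    dense for arbitrary [D]. *)
Definition decides (D : nat -> Prop) (p : nat) : Prop :=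
  D p \/ forall q, extends q p -> ~ D q.

Lemma decides_dense D : dense (decides D).
Proof.
  intros p. destruct (classic (exists q, extends q p /\ D q)) as [(q & Hq & HD)|H].
  - exists q; split; [assumption|now left].
  - exists p; split; [apply extends_refl|right]. intros q Hq HD; eauto.
Qed.

Section Extension.
Variables (C : closed_class) (g : nat -> Prop).
Hypothesis Hg : filter g.
Hypothesis generic : forall D, C D -> exists p, g p /\ decides D p.

Lemma value_mem F p n : g p -> F (pr p n) -> value g F n.
Proof. intros Hp HF. exists p; split; [assumption|]. exists p; split; [apply extends_refl|assumption]. Qed.

(** This plays the role of the truth lemma: a property of all conditions in [g], with complement in
    [C], is inherited by all extensions of one of them. *)
Lemma generic_avoids D : C D -> (forall p, g p -> ~ D p) ->
  exists p, g p /\ forall q, extends q p -> ~ D q.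
Proof.
  intros HD Hn. destruct (generic D HD) as (p & Hp & [H|H]); [|eauto].
  now destruct (Hn p Hp).
Qed.

Lemma value_not_forbidden F p n : g p -> value g F n ->
  exists r, extends r p /\ forces F r n.
Proof.
  intros Hp (q & Hq & HF). destruct (filter_directed g Hg p q Hp Hq) as (r & _ & H1 & H2).
  exists r; split; [assumption|]. now apply (forces_mono F q).
Qed.

Lemma value_decided F n : C F ->
  value g F n \/ exists p, g p /\ forall q, extends q p -> ~ forces F q n.
Proof.
  intros HF. destruct (classic (value g F n)) as [H|H]; [now left|right].
  apply generic_avoids; [apply def_forces; is_fn; assumption|].
  intros p Hp HD. apply H. now exists p.
Qed.

Definition in_extension (A : nat -> Prop) : Prop :=
  exists F, C F /\ forall n, A n <-> value g F n.

Lemma ground_in_extension A : C A -> in_extension A.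
Proof.
  (* The canonical name: every condition puts every element of [A] into the set. *)
  intros HA. exists (fun z => A (pi2 z)). split; [definable|].
  intros n; split.
  - intros Hn. destruct (filter_inhabited g Hg) as [p Hp].
    apply (value_mem _ p); [assumption|]. now rewrite pi2_pr.
  - intros (p & _ & q & _ & H). now rewrite pi2_pr in H.
Qed.

Lemma generic_in_extension : in_extension g.
Proof.
  (* Each condition puts itself into the set; as [g] is closed upwards, the value is [g]. *)
  exists (fun z => pi1 z = pi2 z). split; [definable|].
  intros n; split.
  - intros Hn. apply (value_mem _ n); [assumption|]. now rewrite pi1_pr, pi2_pr.
  - intros (p & Hp & q & Hq & H). rewrite pi1_pr, pi2_pr in H; subst.
    now apply (filter_up g Hg n p).
Qed.

(** If [g] were in [C], its complement would be avoided below some [p] in [g], so all extensions of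
    [p] would lie in [g], although two of them are incompatible. *)
Lemma generic_not_ground : ~ C g.
Proof.
  intros Hgen. destruct (generic_avoids (fun p => ~ g p)) as (p & Hp & H).
  - definable.
  - auto.
  - destruct (incompatible_extensions p) as (q & r & Hq & Hr & Hqr).
    apply Hqr. apply H, NNPP in Hq. apply H, NNPP in Hr.
    destruct (filter_directed g Hg q r Hq Hr) as (x & _ & Hx). now exists x.
Qed.

Lemma extension_pre A f : in_extension A -> in_extension (fun e => A (fapp f e)).
Proof.
  intros (F & HF & HA). exists (fun z => F (pr (pi1 z) (fapp f (pi2 z)))). split.
  - definable.
  - intros n. rewrite HA. unfold value, forces.
    split; intros (p & Hp & q & Hq & H); exists p; split; auto; exists q;
      rewrite ?pi1_pr, ?pi2_pr in *; auto.
Qed.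

(** The name admits [n] at conditions that force the conclusion or have no extension forcing the
    premise. By [value_decided], [g] contains such a condition when the implication holds. *)
Lemma extension_imp A B : in_extension A -> in_extension B ->
  in_extension (fun e => A e -> B e).
Proof.
  intros (F & HF & HA) (H & HH & HB).
  exists (fun z => forces H (pi1 z) (pi2 z)
                   \/ forall q, extends q (pi1 z) -> ~ forces F q (pi2 z)). split.
  - apply def_or; [apply def_forces; is_fn; assumption|].
    apply (def_all C (fun q z => extends q (pi1 z) -> ~ forces F q (pi2 z))).
    apply def_imp; [definable|]. apply def_not, def_forces; is_fn; assumption.
  - intros n. rewrite HA, HB. split.
    + intros Himp. destruct (value_decided F n HF) as [Hv|(p & Hp & Hn)].
      * destruct (Himp Hv) as (p & Hp & Hf). apply (value_mem _ p); [assumption|].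
        rewrite pi1_pr, pi2_pr. now left.
      * apply (value_mem _ p); [assumption|]. rewrite pi1_pr, pi2_pr. now right.
    + intros (p & Hp & q & Hq & HF') Hv. rewrite pi1_pr, pi2_pr in HF'.
      apply (filter_up g Hg q p Hp) in Hq.
      destruct HF' as [Hf|Hn]; [now exists q|].
      destruct (value_not_forbidden F q n Hq Hv) as (r & Hr & Hf). now destruct (Hn r Hr).
Qed.

(** The name admits [n] at [p] if, for every [x], forcing the instance at [x] is dense below [p]. If
    all instances hold, [generic_avoids] excludes conditions below which some instance is never
    forced. *)
Lemma extension_all A : in_extension A -> in_extension (fun e => forall x, A (pr x e)).
Proof.
  intros (F & HF & HA).
  exists (fun z => forall x q, extends q (pi1 z) ->
            exists r, extends r q /\ forces F r (pr x (pi2 z))). split.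
  - definable. apply def_forces; is_fn; assumption.
  - intros n. split.
    + intros Hall.
      destruct (generic_avoids (fun q => exists x, forall r, extends r q -> ~ forces F r (pr x n)))
        as (p & Hp & H).
      * definable. apply def_forces; is_fn; assumption.
      * intros p Hp (x & Hx).
        destruct (value_not_forbidden F p (pr x n) Hp) as (r & Hr & Hf); [now apply HA|].
        now apply (Hx r).
      * apply (value_mem _ p); [assumption|]. rewrite pi1_pr, pi2_pr.
        intros x q Hq. apply NNPP; intros Hn. apply (H q Hq). exists x.
        intros r Hr Hf; eauto.
    + intros (p & Hp & q & Hq & H) x. rewrite pi1_pr, pi2_pr in H.
      apply (filter_up g Hg q p Hp) in Hq. apply HA.
      destruct (value_decided F (pr x n) HF) as [Hv|(p' & Hp' & Hn)]; [assumption|].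
      destruct (filter_directed g Hg q p' Hq Hp') as (r & _ & H1 & H2).
      destruct (H x r H1) as (r' & H3 & H4). exfalso.
      apply (Hn r'); [eapply extends_trans; eauto|assumption].
Qed.

Definition extension : closed_class := {|
  cl := in_extension;
  cl_base := ground_in_extension W (cl_base C);
  cl_pre := extension_pre;
  cl_imp := extension_imp;
  cl_all := extension_all |}.

End Extension.

Definition countable_class (C : closed_class) : Prop :=
  exists enum : nat -> nat -> Prop, forall A, C A -> exists i, enum i = A.

(* If no condition below [p] made the name [F] differ from [Z], then [Z] would be the
   ground set of those [n] that some extension of [p] puts into [F]. *)
Lemma avoids_dense (C : closed_class) F Z : C F -> ~ C Z ->
  dense (fun q => (exists n, forces F q n /\ ~ Z n)
                  \/ exists n, Z n /\ forall r, extends r q -> ~ forces F r n).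
Proof.
  intros HF HZ p. apply NNPP; intros Hn. apply HZ.
  apply (def_ext C (fun n => exists q, extends q p /\ forces F q n)).
  - intros n; split.
    + intros (q & Hq & Hf). apply NNPP; intros HnZ. apply Hn. exists q; eauto.
    + intros Hz. apply NNPP; intros Hne. apply Hn. exists p.
      split; [apply extends_refl|right]. exists n; split; [assumption|].
      intros r Hr Hf; eauto.
  - definable. apply def_forces; is_fn; assumption.
Qed.

Lemma generic_exists (C : closed_class) Z : countable_class C -> ~ C Z ->
  exists g, filter g /\ (forall D, C D -> exists p, g p /\ decides D p) /\ ~ in_extension C g Z.
Proof.
  intros [enum Henum] HZ.
  (* Two kinds of requirements share one index [k]: with first component 0, decide the enumerated
     set; otherwise, prevent it from naming [Z]. The enumeration may also list sets outside [C],
     hence the guard. *)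
  pose (E k := if Nat.eqb (pi1 k) 0 then decides (enum (pi2 k))
    else fun q => C (enum (pi2 k)) ->
     ((exists n, forces (enum (pi2 k)) q n /\ ~ Z n)
       \/ exists n, Z n /\ forall r, extends r q -> ~ forces (enum (pi2 k)) r n)).
  destruct (filter_meeting E) as (g & Hg & Hmeet).
  { intros k. unfold E. destruct (Nat.eqb (pi1 k) 0); [apply decides_dense|].
    destruct (classic (C (enum (pi2 k)))) as [Hc|Hc].
    - intros p. destruct (avoids_dense C _ Z Hc HZ p) as (q & Hq); exists q; tauto.
    - intros p; exists p; split; [apply extends_refl|tauto]. }
  exists g. split; [assumption|split].
  - intros D HD. destruct (Henum D HD) as [i <-]. specialize (Hmeet (pr 0 i)).
    unfold E in Hmeet. now rewrite pi1_pr, pi2_pr in Hmeet.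
  - intros (F & HF & HZF). destruct (Henum F HF) as [i <-]. specialize (Hmeet (pr 1 i)).
    unfold E in Hmeet. rewrite pi1_pr, pi2_pr in Hmeet. cbn in Hmeet.
    destruct Hmeet as (p & Hp & H). destruct (H HF) as [(n & Hf & Hn)|(n & Hz & Hn)].
    + apply Hn, HZF. now exists p.
    + apply HZF in Hz. destruct (value_not_forbidden g Hg _ p n Hp Hz) as (r & Hr & Hf).
      now apply (Hn r).
Qed.

Lemma extension_countable C g Hg generic :
  countable_class C -> countable_class (extension C g Hg generic).
Proof.
  intros [enum Henum]. exists (fun i => value g (enum i)). intros A (F & HF & HA).
  destruct (Henum F HF) as [i <-]. exists i.
  apply functional_extensionality; intros n. apply propositional_extensionality.
  symmetry; apply HA.
Qed.

(** * Coded strings *)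

Fixpoint prod_to (m : nat -> nat) (l : nat) : nat :=
  match l with 0 => 1 | S l => prod_to m l * m l end.

Lemma prod_to_divide m i l : i < l -> Nat.divide (m i) (prod_to m l).
Proof.
  induction l as [|l IH]; intros H; [lia|]. cbn.
  destruct (Nat.eq_dec i l) as [->|Hn].
  - exists (prod_to m l); lia.
  - apply Nat.divide_mul_l, IH; lia.
Qed.

Lemma prod_to_coprime m l k : (forall i, i < l -> Nat.gcd (m i) k = 1) ->
  Nat.gcd (prod_to m l) k = 1.
Proof.
  induction l as [|l IH]; intros H; [reflexivity|]. cbn.
  apply Nat.divide_1_r.
  pose proof (Nat.gcd_divide (prod_to m l * m l) k) as [H1 H2].
  assert (Nat.gcd (Nat.gcd (prod_to m l * m l) k) (prod_to m l) = 1) as E.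
  { apply Nat.divide_1_r. rewrite <- IH by (intros; apply H; lia).
    apply Nat.gcd_greatest; [apply Nat.gcd_divide_r|].
    eapply Nat.divide_trans; [apply Nat.gcd_divide_l|exact H2]. }
  apply (Nat.gauss _ _ _ H1) in E.
  rewrite <- (H l) by lia. now apply Nat.gcd_greatest.
Qed.

Lemma chinese_remainder (m h : nat -> nat) l : (forall i, h i < m i) ->
  (forall i j, i < j -> j < l -> Nat.gcd (m i) (m j) = 1) ->
  exists a, forall i, i < l -> exists q, a = q * m i + h i.
Proof.
  intros Hm. induction l as [|l IH]; intros Hc; [exists 0; lia|].
  destruct IH as [a0 Ha0]; [auto|].
  assert (Nat.gcd (prod_to m l) (m l) = 1) as E by (apply prod_to_coprime; auto).
  assert (Hpos : prod_to m l <> 0).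
  { intros E0. rewrite E0, Nat.gcd_0_l in E. clear - Hm E0.
    induction l as [|l IH]; cbn in E0; [lia|]. specialize (Hm l). nia. }
  destruct (Nat.gcd_bezout_pos (prod_to m l) (m l)) as (u & v & Huv); [lia|].
  rewrite E in Huv.
  (* Modulo [m l] this is h l - a0, written without subtraction; [u] inverts the product modulo
     [m l], so adding u * k times the product corrects the last remainder and keeps the earlier
     ones. *)
  set (k := h l + (m l - 1) * a0).
  exists (a0 + u * k * prod_to m l). intros i Hi.
  destruct (Nat.eq_dec i l) as [->|Hn].
  - exists (a0 + v * k). specialize (Hm l).
    replace (u * k * prod_to m l) with (k + v * k * m l) by nia.
    assert (k + a0 = h l + m l * a0) by (unfold k; nia). nia.
  - destruct (Ha0 i) as [q Hq]; [lia|].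
    destruct (prod_to_divide m i l) as [d Hd]; [lia|].
    exists (q + u * k * d). rewrite Hq, Hd. nia.
Qed.

(** A common divisor divides b * (j - i) and is coprime to [b], so it divides j - i, hence [b],
    hence 1. *)
Lemma beta_coprime b i j : i < j -> Nat.divide (j - i) b ->
  Nat.gcd (b * (i + 1) + 1) (b * (j + 1) + 1) = 1.
Proof.
  intros Hij Hb. apply Nat.divide_1_r.
  set (x := b * (i + 1) + 1). set (y := b * (j + 1) + 1).
  destruct (Nat.gcd_divide x y) as [H1 H2]. set (d := Nat.gcd x y) in *.
  assert (Hd : Nat.divide d (b * (j - i))).
  { replace (b * (j - i)) with (y - x) by (unfold x, y; nia). now apply Nat.divide_sub_r. }
  assert (E : Nat.gcd d b = 1).
  { apply Nat.divide_1_r. apply (Nat.divide_add_cancel_r _ (b * (i + 1))).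
    - apply Nat.divide_mul_l, Nat.gcd_divide_r.
    - eapply Nat.divide_trans; [apply Nat.gcd_divide_l|exact H1]. }
  apply (Nat.gauss _ _ _ Hd) in E.
  apply (Nat.divide_add_cancel_r _ (b * (i + 1))); [|exact H1].
  apply Nat.divide_mul_l. eapply Nat.divide_trans; eauto.
Qed.

Lemma divide_fact k l : 0 < k -> k <= l -> Nat.divide k (fact l).
Proof.
  intros Hk Hl. induction l as [|l IH]; [lia|].
  change (fact (S l)) with (S l * fact l).
  destruct (Nat.eq_dec k (S l)) as [->|Hn]; [apply Nat.divide_factor_l|].
  apply Nat.divide_mul_r, IH; lia.
Qed.

Lemma bounded_on (h : nat -> nat) l : exists c, forall i, i < l -> h i < c.
Proof.
  induction l as [|l [c Hc]]; [exists 0; lia|].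
  exists (c + h l + 1). intros i Hi. destruct (Nat.eq_dec i l) as [->|Hn]; [lia|].
  specialize (Hc i); lia.
Qed.

Lemma Ent_functional s i v w : Ent s i v -> Ent s i w -> v = w.
Proof.
  intros (l & a & b & -> & _ & Hv & q & Hq) (l' & a' & b' & E & _ & Hw & q' & Hq').
  apply pr_inj in E as [_ E]. apply pr_inj in E as [-> ->].
  enough (q = q') by nia. nia.
Qed.

Lemma Ent_Lh s i v l : Ent s i v -> Lh s l -> i < l.
Proof.
  intros (l' & a & b & -> & H & _) (a' & b' & E). apply pr_inj in E as [<- _]. assumption.
Qed.

(** Goedel's beta function lemma: every finite sequence has a code. *)
Lemma string_exists (h : nat -> nat) l :
  exists s, Lh s l /\ forall i v, Ent s i v <-> i < l /\ v = h i.
Proof.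
  destruct (bounded_on h l) as [c Hc].
  (* Padding by 0, because [chinese_remainder] bounds the remainders at all indices. *)
  set (h' i := if i <? l then h i else 0).
  (* The factorial is divisible by all differences of indices below [l], making the moduli coprime;
     [c] makes them exceed the entries. *)
  set (b := fact l * c).
  destruct (chinese_remainder (fun i => b * (i + 1) + 1) h' l) as [a Ha].
  { intros i. unfold h'. destruct (Nat.ltb_spec i l) as [Hi|Hi]; [|lia].
    specialize (Hc i Hi). pose proof (lt_O_fact l). unfold b. nia. }
  { intros i j Hij Hj. apply beta_coprime; [assumption|].
    apply Nat.divide_mul_l, divide_fact; lia. }
  exists (pr l (pr a b)).
  assert (Hent : forall i, i < l -> Ent (pr l (pr a b)) i (h i)).
  { intros i Hi. exists l, a, b. repeat split; [assumption| |].
    - specialize (Hc i Hi). pose proof (lt_O_fact l). unfold b. nia.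
    - destruct (Ha i Hi) as [q Hq]. exists q. unfold h' in Hq.
      apply Nat.ltb_lt in Hi. now rewrite Hi in Hq. }
  split; [now exists a, b|]. intros i v; split.
  - intros Hv. assert (Hi : i < l) by (apply (Ent_Lh _ _ _ _ Hv); now exists a, b).
    split; [assumption|]. eapply Ent_functional; eauto.
  - intros [Hi ->]; auto.
Qed.

(** * Perfect subtrees from new paths *)

(** These predicates copy the formulas of the same names clause by clause, so that [wMPT_meaning]
    holds up to conversion. *)
Definition Pre (s t : nat) : Prop :=
  Str s /\ Str t /\ forall i v, Ent s i v -> Ent t i v.
Definition Tree (T : nat -> Prop) : Prop :=
  (forall s, T s -> Str s) /\ (forall s t, T t /\ Pre s t -> T s).
Definition Real (F : nat -> Prop) : Prop :=
  (forall p, F p -> exists i v, p = pr i v) /\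
  (forall i, exists v, F (pr i v) /\ forall w, F (pr i w) -> w = v).
Definition Path (F T : nat -> Prop) : Prop :=
  Real F /\ forall s, Str s /\ (forall i v, Ent s i v -> F (pr i v)) -> T s.
Definition Subtree (P T : nat -> Prop) : Prop := Tree P /\ forall s, P s -> T s.
Definition Perfect (P : nat -> Prop) : Prop :=
  (exists s, P s) /\
  (forall s, P s -> exists t u, P t /\ P u /\ Pre s t /\ Pre s u /\ ~ Pre t u /\ ~ Pre u t).

Section PerfectSubtree.
Variables (C : closed_class) (g F : nat -> Prop).
Hypothesis Hg : filter g.
Hypothesis generic : forall D, C D -> exists p, g p /\ decides D p.
Hypothesis HF : C F.
Notation Y := (value g F).

Let undecided (q : nat) : Prop := exists i v w r r',
  extends r q /\ extends r' q /\ forces F r (pr i v) /\ forces F r' (pr i w) /\ v <> w.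
Let conflict (q : nat) : Prop := exists i v w,
  forces F q (pr i v) /\ forces F q (pr i w) /\ v <> w.
Let partial (q : nat) : Prop := exists i, forall r, extends r q -> forall v, ~ forces F r (pr i v).
Let approx (s q : nat) : Prop := forall i v, Ent s i v -> forces F q (pr i v).
Let leaves (T : nat -> Prop) (q : nat) : Prop := exists s, Str s /\ approx s q /\ ~ T s.

(** If [p] allowed only one value at each place, the pairs forced by extensions of [p] would be
    exactly the elements of the real, which would then lie in [C]. *)
Lemma new_real_undecided : Real Y -> ~ C Y -> forall p, g p -> undecided p.
Proof.
  intros [HY1 HY2] Hnew p Hp. apply NNPP; intros Hn. apply Hnew.
  apply (def_ext C (fun z => exists i v, z = pr i v /\ exists r, extends r p /\ forces F r z)).
  - intros z; split.
    + intros (i & v & -> & r & Hr & Hf). destruct (HY2 i) as (w & Hw & _).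
      destruct (value_not_forbidden g Hg F p (pr i w) Hp Hw) as (r' & Hr' & Hf').
      destruct (Nat.eq_dec v w) as [->|Hvw]; [assumption|].
      exfalso. apply Hn. exists i, v, w, r, r'. auto.
    + intros Hz. destruct (HY1 z Hz) as (i & v & ->). exists i, v. split; [reflexivity|].
      now apply (value_not_forbidden g Hg F p).
  - definable. apply def_forces; is_fn; assumption.
Qed.

(** Conditions in [g] are all undecided and have none of the three defects, as the value is a new
    path of [T]. Four uses of [generic_avoids] and a common extension spread this to everything
    below one [p]. *)
Lemma path_condition T : C T -> Path Y T -> ~ C Y -> exists p, g p /\
  forall q, extends q p -> undecided q /\ ~ conflict q /\ ~ partial q /\ ~ leaves T q.
Proof.
  intros HT [HY HYT] Hnew.
  destruct (generic_avoids C g generic (fun q => ~ undecided q)) as (p1 & Hp1 & H1).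
  { unfold undecided. definable; apply def_forces; is_fn; assumption. }
  { intros p Hp Hn. now apply Hn, new_real_undecided. }
  destruct (generic_avoids C g generic conflict) as (p2 & Hp2 & H2).
  { unfold conflict. definable; apply def_forces; is_fn; assumption. }
  { intros p Hp (i & v & w & Hv & Hw & Hvw). apply Hvw.
    destruct HY as [_ HY]. destruct (HY i) as (x & _ & Hx).
    rewrite (Hx v), (Hx w); [reflexivity| |]; now exists p. }
  destruct (generic_avoids C g generic partial) as (p3 & Hp3 & H3).
  { unfold partial. definable; apply def_forces; is_fn; assumption. }
  { intros p Hp (i & Hi). destruct HY as [_ HY]. destruct (HY i) as (x & Hx & _).
    destruct (value_not_forbidden g Hg F p (pr i x) Hp Hx) as (r & Hr & Hf).
    now apply (Hi r Hr x). }
  destruct (generic_avoids C g generic (leaves T)) as (p4 & Hp4 & H4).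
  { unfold leaves, approx. definable; apply def_forces; is_fn; assumption. }
  { intros p Hp (s & Hs & Hsp & Hn). apply Hn, HYT. split; [assumption|].
    intros i v Hv. exists p; auto. }
  destruct (filter_directed g Hg p1 p2 Hp1 Hp2) as (q1 & Hq1 & E1 & E2).
  destruct (filter_directed g Hg p3 p4 Hp3 Hp4) as (q2 & Hq2 & E3 & E4).
  destruct (filter_directed g Hg q1 q2 Hq1 Hq2) as (p & Hp & E5 & E6).
  exists p; split; [assumption|]. intros q Hq.
  assert (F1 := extends_trans _ _ _ Hq (extends_trans _ _ _ E5 E1)).
  assert (F2 := extends_trans _ _ _ Hq (extends_trans _ _ _ E5 E2)).
  assert (F3 := extends_trans _ _ _ Hq (extends_trans _ _ _ E6 E3)).
  assert (F4 := extends_trans _ _ _ Hq (extends_trans _ _ _ E6 E4)).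
  split; [exact (NNPP _ (H1 q F1))|]. split; [exact (H2 q F2)|].
  split; [exact (H3 q F3)|exact (H4 q F4)].
Qed.

(** The condition is extended one entry at a time; the absence of [partial] always leaves room for
    the next. *)
Lemma forced_entries p l : (forall q, extends q p -> ~ partial q) ->
  forall q, extends q p ->
  exists r h, extends r q /\ forall i, i < l -> forces F r (pr i (h i)).
Proof.
  intros Hp q Hq. induction l as [|l (r & h & Hr & Hh)].
  - exists q, (fun i => i). split; [apply extends_refl|lia].
  - destruct (classic (exists r', extends r' r /\ exists v, forces F r' (pr l v)))
      as [(r' & Hr' & v & Hv)|Hn].
    + exists r', (fun i => if Nat.eqb i l then v else h i).
      split; [eapply extends_trans; eauto|]. intros i Hi.
      destruct (Nat.eqb_spec i l) as [->|Hil]; [assumption|].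
      apply (forces_mono F r); [assumption|]. apply Hh; lia.
    + exfalso. apply (Hp r); [eapply extends_trans; eauto|].
      exists l. intros r' Hr' v Hv. eauto.
Qed.

Lemma approx_extension p s q i v :
  (forall q, extends q p -> ~ conflict q /\ ~ partial q) ->
  extends q p -> Str s -> approx s q -> (exists r, extends r q /\ forces F r (pr i v)) ->
  exists t r, extends r p /\ approx t r /\ Pre s t /\ Ent t i v.
Proof.
  intros Hp Hq [l Hl] Hs (r & Hr & Hv).
  (* Long enough to prolong [s], of length [l], and to include place [i]; the absence of [conflict]
     makes the forced entries agree with [s] and with [v]. *)
  destruct (forced_entries p (l + i + 1)) with (q := r) as (r' & h & Hr' & Hh).
  - intros x Hx; now apply Hp.
  - exact (extends_trans _ _ _ Hr Hq).
  - assert (Hrp := extends_trans _ _ _ Hr' (extends_trans _ _ _ Hr Hq)).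
    assert (Hfun : forall j w, j < l + i + 1 -> forces F r' (pr j w) -> w = h j).
    { intros j w Hj Hw. apply NNPP; intros Hn. apply (proj1 (Hp r' Hrp)).
      exists j, w, (h j). auto. }
    destruct (string_exists h (l + i + 1)) as (t & Ht & Hent).
    exists t, r'. split; [assumption|]. split; [|split].
    + intros j w Hw. apply Hent in Hw as [Hj ->]. auto.
    + split; [now exists l|]. split; [now exists (l + i + 1)|].
      intros j w Hw. apply Hent. assert (Hj := Ent_Lh _ _ _ _ Hw Hl).
      split; [lia|]. apply Hfun; [lia|].
      apply (forces_mono F q); [exact (extends_trans _ _ _ Hr' Hr)|auto].
    + apply Hent. split; [lia|]. apply Hfun; [lia|]. now apply (forces_mono F r).
Qed.

(* The subtree consists of the strings that some condition below [p] forces to be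
   initial segments of the new path. *)
Lemma new_path_perfect_subtree T : C T -> Path Y T -> ~ C Y ->
  exists P, C P /\ Subtree P T /\ Perfect P.
Proof.
  intros HT HYT Hnew. destruct (path_condition T HT HYT Hnew) as (p & _ & Hp).
  exists (fun s => Str s /\ exists q, extends q p /\ approx s q).
  split; [|split; [split; [split|]|split]].
  - unfold approx. definable; apply def_forces; is_fn; assumption.
  - now intros s [Hs _].
  - intros s t [(_ & q & Hq & Ht) (Hs & _ & Hst)]. split; [assumption|].
    exists q; split; [assumption|]. intros i v Hv; auto.
  - intros s (Hs & q & Hq & Ha). apply NNPP; intros Hn.
    destruct (Hp q Hq) as (_ & _ & _ & Hl). apply Hl. now exists s.
  (* The empty string. *)
  - destruct (string_exists (fun i => i) 0) as (s & Hs & Hent). exists s.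
    split; [now exists 0|]. exists p; split; [apply extends_refl|].
    intros i v Hv. apply Hent in Hv as [Hi _]. lia.
  - intros s (Hs & q & Hq & Ha).
    destruct (Hp q Hq) as ((i & v & w & r & r' & Hr & Hr' & Hv & Hw & Hvw) & _).
    assert (Hcp : forall q, extends q p -> ~ conflict q /\ ~ partial q)
      by (intros x Hx; destruct (Hp x Hx); tauto).
    (* Two values possible at the same place [i] give two incompatible prolongations of [s]. *)
    destruct (approx_extension p s q i v Hcp Hq Hs Ha) as (t & rt & H1 & H2 & H3 & H4); [eauto|].
    destruct (approx_extension p s q i w Hcp Hq Hs Ha) as (u & ru & H5 & H6 & H7 & H8); [eauto|].
    exists t, u.
    split; [split; [apply H3|eauto]|]. split; [split; [apply H7|eauto]|].
    split; [assumption|]. split; [assumption|].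
    split; intros (_ & _ & Hpre); apply Hvw.
    + apply Hpre in H4. eapply Ent_functional; eauto.
    + apply Hpre in H8. eapply Ent_functional; eauto.
Qed.
End PerfectSubtree.

(** * Turing reducibility *)

Definition Reg (R r v : nat) : Prop :=
  Ent R r v \/ ((exists l, Lh R l /\ ~ r < l) /\ v = 0).
Definition Update (R r v R' : nat) : Prop :=
  Reg R' r v /\ forall q u, ~ q = r -> (Reg R q u <-> Reg R' q u).
Definition Step (e : nat) (Y : nat -> Prop) (c c' : nat) : Prop :=
  exists p R p' R' o r k,
    c = pr p R /\ c' = pr p' R' /\ Ent e p (pr o (pr r k)) /\
    ( (o = 0 /\ p' = p + 1 /\ exists v, Reg R r v /\ Update R r (v + 1) R')
   \/ (o = 1 /\ ( (Reg R r 0 /\ R' = R /\ p' = k)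
               \/ (p' = p + 1 /\ exists v, Reg R r (v + 1) /\ Update R r v R')))
   \/ (o = 1 + 1 /\ R' = R /\
       exists v, Reg R r v /\ ((Y v /\ p' = p + 1) \/ (~ Y v /\ p' = k)))).
Definition Computes (e : nat) (Y : nat -> Prop) (n v : nat) : Prop :=
  exists c t, Lh c (t + 1) /\
    (exists R, Ent c 0 (pr 0 R) /\ Reg R 0 n /\ forall r, ~ r = 0 -> Reg R r 0) /\
    (forall i, i < t -> exists x y, Ent c i x /\ Ent c (i + 1) y /\ Step e Y x y) /\
    (exists p R, Ent c t (pr p R) /\ Lh e p /\ Reg R 0 v).
Definition Turing_le (X Y : nat -> Prop) : Prop :=
  exists e, forall n, (X n -> Computes e Y n 1) /\ (~ X n -> Computes e Y n 0).

Lemma Reg_functional R r v w : Reg R r v -> Reg R r w -> v = w.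
Proof.
  intros [H|[(l & Hl & Hr) ->]] [H'|[(l' & Hl' & Hr') ->]].
  - eapply Ent_functional; eauto.
  - now destruct (Hr' (Ent_Lh _ _ _ _ H Hl')).
  - now destruct (Hr (Ent_Lh _ _ _ _ H' Hl)).
  - reflexivity.
Qed.

(** Register strings have several codes and may differ by trailing zeros, so runs are compared by
    register contents only. *)
Definition same_regs (R R' : nat) : Prop := forall q u, Reg R q u <-> Reg R' q u.

Lemma Update_same R S r v R' S' : same_regs R S -> Update R r v R' -> Update S r v S' ->
  same_regs R' S'.
Proof.
  intros H [H1 H2] [H3 H4] q u. destruct (Nat.eq_dec q r) as [->|Hq].
  - split; intros Hu.
    + now rewrite (Reg_functional _ _ _ _ Hu H1).
    + now rewrite (Reg_functional _ _ _ _ Hu H3).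
  - rewrite <- (H2 q u Hq), <- (H4 q u Hq). apply H.
Qed.

Lemma Step_deterministic e Y p R S c d : same_regs R S ->
  Step e Y (pr p R) c -> Step e Y (pr p S) d ->
  exists p' R' S', c = pr p' R' /\ d = pr p' S' /\ same_regs R' S'.
Proof.
  intros HRS (p1 & R1 & p' & R' & o & r & k & E1 & -> & He & HR)
             (p2 & S1 & p'' & S' & o' & r' & k' & E2 & -> & He' & HS).
  apply pr_inj in E1 as [<- <-]. apply pr_inj in E2 as [<- <-].
  assert (E := Ent_functional _ _ _ _ He He').
  apply pr_inj in E as [<- E]. apply pr_inj in E as [<- <-].
  enough (p'' = p' /\ same_regs R' S') as [-> H] by (exists p', R', S'; auto).
  destruct HR as [(-> & -> & v & Hv & Hu)|[(-> & HR)|(-> & -> & v & Hv & HY)]];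
    destruct HS as [(E & -> & v' & Hv' & Hu')|[(E & HS)|(E & -> & v' & Hv' & HY')]];
    try discriminate.
  - apply HRS in Hv. assert (v = v') as <- by (eapply Reg_functional; eauto).
    split; [reflexivity|]. eapply Update_same; eauto.
  - destruct HR as [(H0 & -> & ->)|(-> & v & Hv & Hu)];
      destruct HS as [(H0' & -> & ->)|(-> & v' & Hv' & Hu')].
    + now split.
    + apply HRS in H0. assert (0 = v' + 1) by (eapply Reg_functional; eauto). lia.
    + apply HRS in Hv. assert (0 = v + 1) by (eapply Reg_functional; eauto). lia.
    + apply HRS in Hv. assert (v + 1 = v' + 1) by (eapply Reg_functional; eauto).
      assert (v = v') as <- by lia. split; [reflexivity|]. eapply Update_same; eauto.
  - apply HRS in Hv. assert (v = v') as <- by (eapply Reg_functional; eauto).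
    destruct HY as [(Hy & ->)|(Hy & ->)], HY' as [(Hy' & ->)|(Hy' & ->)]; tauto.
Qed.

(** Two runs agree step by step up to [same_regs], and neither can continue once the other has
    halted. *)
Lemma Computes_functional e Y n v w : Computes e Y n v -> Computes e Y n w -> v = w.
Proof.
  intros (c & t & _ & (R0 & HR0 & HR0n & HR0z) & Hc & (p & R & HR & Hp & HRv))
         (d & t' & _ & (S0 & HS0 & HS0n & HS0z) & Hd & (p' & R' & HS & Hp' & HSw)).
  assert (Hrun : forall i, i <= t -> i <= t' -> exists x A B,
            Ent c i (pr x A) /\ Ent d i (pr x B) /\ same_regs A B).
  { induction i as [|i IH]; intros Hi Hi'.
    - exists 0, R0, S0. repeat split; try assumption.
      + intros Hu. destruct (Nat.eq_dec q 0) as [->|Hq].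
        * now rewrite (Reg_functional _ _ _ _ Hu HR0n).
        * rewrite (Reg_functional _ _ _ _ Hu (HR0z q Hq)). auto.
      + intros Hu. destruct (Nat.eq_dec q 0) as [->|Hq].
        * now rewrite (Reg_functional _ _ _ _ Hu HS0n).
        * rewrite (Reg_functional _ _ _ _ Hu (HS0z q Hq)). auto.
    - destruct IH as (x & A & B & HA & HB & HAB); [lia|lia|].
      destruct (Hc i) as (a & b & Ha & Hb & Hstep); [lia|].
      destruct (Hd i) as (a' & b' & Ha' & Hb' & Hstep'); [lia|].
      rewrite (Ent_functional _ _ _ _ Ha HA) in Hstep.
      rewrite (Ent_functional _ _ _ _ Ha' HB) in Hstep'.
      destruct (Step_deterministic _ _ _ _ _ _ _ HAB Hstep Hstep')
        as (x' & A' & B' & -> & -> & H).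
      exists x', A', B'. now replace (S i) with (i + 1) by lia. }
  (* At the halting position, the length of [e], there is no instruction, so no further step
     exists. *)
  assert (Hhalt : forall c t u i x A q, Ent c i (pr x A) -> Lh e x ->
      (forall i, i < t -> exists x y, Ent c i x /\ Ent c (i + 1) y /\ Step e Y x y) ->
      t = u -> q = i -> ~ q < t).
  { intros c' t1 u i x A q Hi Hx Hs _ -> Hlt. destruct (Hs i Hlt) as (a & b & Ha & _ & Hst).
    rewrite (Ent_functional _ _ _ _ Ha Hi) in Hst.
    destruct Hst as (p1 & R1 & _ & _ & o & r & k & E & _ & He & _).
    apply pr_inj in E as [<- _]. assert (H := Ent_Lh _ _ _ _ He Hx). lia. }
  destruct (Hrun (min t t')) as (x & A & B & HA & HB & HAB); [lia|lia|].
  assert (t = t') as <-.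
  { destruct (Nat.lt_trichotomy t t') as [Hlt|[E|Hlt]]; [|assumption|]; exfalso.
    - replace (min t t') with t in * by lia.
      assert (E := Ent_functional _ _ _ _ HA HR). apply pr_inj in E as [-> ->].
      apply (Hhalt d t' t' t p B t); auto.
    - replace (min t t') with t' in * by lia.
      assert (E := Ent_functional _ _ _ _ HB HS). apply pr_inj in E as [-> ->].
      apply (Hhalt c t t t' p' A t'); auto. }
  rewrite Nat.min_id in *.
  assert (E := Ent_functional _ _ _ _ HA HR). apply pr_inj in E as [_ ->].
  assert (E := Ent_functional _ _ _ _ HB HS). apply pr_inj in E as [_ ->].
  apply HAB in HRv. eapply Reg_functional; eauto.
Qed.

Lemma Computes_definable (C : closed_class) Y e v : C Y -> C (fun n => Computes e Y n v).
Proof.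
  intros HY.
  (* At level 3 the number variables 0, 1, 2 are [n], [e], [v]; set variable 0 is the oracle. *)
  set (p := computes (fun m => tvar (m - 2)) (fun _ => 0) (fun m => tvar (m - 3))
              (fun m => tvar (m - 1)) 3 0).
  apply (def_ext C (fun n => sat C (scons n (env (pr e (pr v 0)))) (fun _ => Y) p)).
  (* Occurrences 2 and 3 of [iff] come from the two uses of [Update] in [Step]; the first is the
     goal itself. *)
  - intros n. rewrite !env_pr. unfold Computes, Step, Update, Reg, Ent, Lh, iff at 2 3.
    rewrite and_encoded, or_encoded, ex_encoded. reflexivity.
  - apply arithmetical_comprehension; [cbn; tauto|auto].
Qed.

Lemma Turing_le_closed (C : closed_class) X Y : C Y -> Turing_le X Y -> C X.
Proof.
  intros HY [e He]. apply (def_ext C (fun n => Computes e Y n 1)).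
  - intros n. destruct (He n) as [H1 H0]. split; [|exact H1].
    intros H. apply NNPP; intros Hn.
    discriminate (Computes_functional _ _ _ _ _ H (H0 Hn)).
  - now apply Computes_definable.
Qed.

Lemma wMPT_meaning M rho sigma :
  (forall T, M T ->
     Tree T /\ (forall X, M X -> Real X -> exM M (fun Y => Path Y T /\ Turing_le X Y)) ->
     exM M (fun P => Subtree P T /\ Perfect P)) ->
  sat M rho sigma wMPT.
Proof.
  unfold Subtree, Perfect, Path, Tree, Real, Turing_le, Computes, Step, Update, Reg, Pre, Ent,
    Str, Lh, iff.
  sat_meaning.
Qed.

(** * The tower of generic extensions *)

Fixpoint den (x : sx) (e : nat) : Prop :=
  match x with
  | SBase => W e
  | SPre f a => den a (fapp f e)
  | SImp a b => den a e -> den b e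
  | SAll a => forall x, den a (pr x e)
  end.

Definition ground : closed_class.
Proof.
  refine {| cl := fun A => exists x, A = den x |}.
  - now exists SBase.
  - intros A f [x ->]. now exists (SPre f x).
  - intros A B [x ->] [y ->]. now exists (SImp x y).
  - intros A [x ->]. now exists (SAll x).
Defined.

Lemma ground_countable : countable_class ground.
Proof.
  exists (fun j e => exists x, sx_code x = j /\ den x e). intros A [x ->].
  exists (sx_code x).
  apply functional_extensionality; intros e. apply propositional_extensionality; split.
  - intros (y & E & H). apply sx_code_inj in E. now subst.
  - eauto.
Qed.

(** Cantor's diagonal set for the coded definitions; this is the set kept out of the whole tower. *)
Definition diagonal (j : nat) : Prop := exists x, sx_code x = j /\ ~ den x j.

Lemma diagonal_not_ground : ~ ground diagonal.
Proof.
  intros [x Hx]. assert (H : diagonal (sx_code x) <-> den x (sx_code x)) by now rewrite Hx.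
  assert (H' : diagonal (sx_code x) <-> ~ den x (sx_code x)).
  { split; [|now exists x]. intros (y & E & Hy). apply sx_code_inj in E. now subst. }
  tauto.
Qed.

Record good_step (C C' : closed_class) : Prop := {
  step_incl A : C A -> C' A;
  step_real : exists X, Real X /\ C' X /\ ~ C X;
  step_perfect T Y : C T -> C' Y -> ~ C Y -> Path Y T ->
    exists P, C P /\ Subtree P T /\ Perfect P }.

(** Cofinality speaks of graphs of functions, so the generic enters through its characteristic
    function. *)
Lemma characteristic_real (g : nat -> Prop) :
  Real (fun z => exists i v, z = pr i v /\ (v = 1 /\ g i \/ v = 0 /\ ~ g i)).
Proof.
  split.
  - intros p (i & v & -> & _); eauto.
  - intros i. assert (Hpr : forall v, (exists i' v', pr i v = pr i' v' /\
                        (v' = 1 /\ g i' \/ v' = 0 /\ ~ g i')) -> v = 1 /\ g i \/ v = 0 /\ ~ g i).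
    { intros v (i' & v' & E & H). apply pr_inj in E as [<- <-]. assumption. }
    destruct (classic (g i)) as [H|H]; [exists 1|exists 0]; (split; [eauto 8|]);
      intros w Hw; apply Hpr in Hw; tauto.
Qed.

Lemma good_step_exists (C : closed_class) Z : countable_class C -> ~ C Z ->
  exists C', (countable_class C' /\ ~ C' Z) /\ good_step C C'.
Proof.
  intros Hc HZ. destruct (generic_exists C Z Hc HZ) as (g & Hg & Hgen & HZ').
  exists (extension C g Hg Hgen).
  split; [split; [now apply extension_countable|assumption]|].
  split.
  - intros A HA. now apply ground_in_extension.
  - eexists. split; [apply (characteristic_real g)|split].
    + assert (extension C g Hg Hgen g) by now apply generic_in_extension.
      definable.
    + intros H. apply (generic_not_ground C g Hg Hgen).
      revert H. set (X := fun z => _). intros H.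
      apply (def_ext C (fun i => X (pr i 1))); [|definable].
      intros i; unfold X; split; [|eauto 8].
      intros (i' & v & E & Hv). apply pr_inj in E as [<- <-]. intuition discriminate.
  - intros T Y HT (F & HF & HY) Hnew HP.
    assert (Y = value g F) as ->.
    { apply functional_extensionality; intros n. now apply propositional_extensionality. }
    now apply (new_path_perfect_subtree C g F).
Qed.

Lemma tower_exists Z (C : closed_class) : countable_class C -> ~ C Z ->
  exists K : nat -> closed_class,
    (forall i, ~ K i Z) /\ forall i, good_step (K i) (K (S i)).
Proof.
  intros Hc HZ.
  (* This invariant is what [good_step_exists] needs in order to be iterated. *)
  pose (inv C := countable_class C /\ ~ C Z).
  assert (next : forall c : {C | inv C}, {c' : {C | inv C} | good_step (proj1_sig c) (proj1_sig c')}).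
  { intros [D [HD1 HD2]]. apply constructive_indefinite_description.
    destruct (good_step_exists D Z HD1 HD2) as (D' & H & H').
    now exists (exist _ D' H). }
  pose (K := fix K i : {C | inv C} := match i with
      | 0 => exist _ C (conj Hc HZ)
      | S i => proj1_sig (next (K i)) end).
  exists (fun i => proj1_sig (K i)). split.
  - intros i. apply (proj2_sig (K i)).
  - intros i. exact (proj2_sig (next (K i))).
Qed.

Section Union.
Variable K : nat -> closed_class.
Hypothesis HK : forall i, good_step (K i) (K (S i)).

Lemma tower_mono i j A : i <= j -> K i A -> K j A.
Proof.
  induction 1 as [|j _ IH]; [auto|]. intros H. now apply (step_incl _ _ (HK j)), IH.
Qed.

Definition tower_union : closed_class.
Proof.
  refine {| cl := fun A => exists i, K i A |}.
  - exists 0. apply cl_base.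
  - intros A f [i H]. exists i. now apply cl_pre.
  - intros A B [i HA] [j HB]. exists (max i j).
    apply cl_imp; [apply (tower_mono i)|apply (tower_mono j)]; (assumption || lia).
  - intros A [i H]. exists i. now apply cl_all.
Defined.

Lemma first_appearance Y i j : ~ K i Y -> K j Y ->
  exists k, i <= k /\ ~ K k Y /\ K (S k) Y.
Proof.
  intros Hi. induction j as [|j IH]; intros Hj.
  - exfalso. apply Hi, (tower_mono 0); [lia|assumption].
  - destruct (classic (K j Y)) as [H|H]; [auto|].
    exists j. split; [|auto]. destruct (Nat.le_gt_cases i j) as [Hle|Hgt]; [assumption|].
    exfalso. apply Hi, (tower_mono (S j)); assumption.
Qed.

Lemma tower_wMPT : valid tower_union wMPT.
Proof.
  intros e sigma _. apply wMPT_meaning. intros T [i HT] [_ Hcof].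
  (* A path computing [X] cannot lie in [K i], which is closed under Turing reducibility. *)
  destruct (step_real _ _ (HK i)) as (X & HX & HX1 & HX0).
  destruct (Hcof X) as (Y & [j HY] & HP & HXY); [now exists (S i)|assumption|].
  destruct (first_appearance Y i j) as (k & Hik & Hk0 & Hk1).
  - intros H. apply HX0. now apply (Turing_le_closed _ X Y).
  - assumption.
  - destruct (step_perfect _ _ (HK k) T Y) as (P & H1 & H2); try assumption.
    + now apply (tower_mono i).
    + exists P. split; [now exists k|assumption].
Qed.
End Union.

(** * Failure of transfinite recursion *)

(** The four cases are the clauses of [den], with [Z] holding the columns already built. Numerals
    are sums of 1 as in the object language. *)
Definition Theta (w Z : nat -> Prop) (n : nat) : Prop :=
  n = 0 \/ exists e, n = e + 1 /\ exists j,
    (forall i, i < j -> Z (pr 0 i)) /\ ~ Z (pr 0 j) /\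
    ( (j = pr 1 0 /\ w e)
   \/ (exists i a, j = pr (1 + 1) (pr i a) /\
         exists y, w (pr 1 (pr i (pr e y))) /\ Z (pr (y + 1) a))
   \/ (exists a b, j = pr (1 + 1 + 1) (pr a b) /\ (Z (pr (e + 1) a) -> Z (pr (e + 1) b)))
   \/ (exists a, j = pr (1 + 1 + 1 + 1) a /\ forall x, Z (pr (pr x e + 1) a))).

(* The column of index [j] always contains 0, so that [j] can be read off from the
   columns below it; its other elements [e + 1] are to form the set with code [j]. *)
Definition truth_fm (n : ntm) (w Z : nset) : fm :=
  (n = 0 \/ exn e, n = e + 1 /\ exn j,
    (alln i, i < j ==> cpair 0 i ∈ Z) /\ ~ cpair 0 j ∈ Z /\
    ( (j = cpair 1 0 /\ e ∈ w)
   \/ (exn i a, j = cpair (1 + 1) (cpair i a) /\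
         exn y, cpair 1 (cpair i (cpair e y)) ∈ w /\ cpair (y + 1) a ∈ Z)
   \/ (exn a b, j = cpair (1 + 1 + 1) (cpair a b) /\
         (cpair (e + 1) a ∈ Z ==> cpair (e + 1) b ∈ Z))
   \/ (exn a, j = cpair (1 + 1 + 1 + 1) a /\ alln x, cpair (cpair x e + 1) a ∈ Z)))%so.

Definition truth_form : form := truth_fm (fun m => tvar (m - 1)) (fun _ => 1) (fun _ => 0) 1 1.

Lemma truth_form_arithmetical : arithmetical truth_form.
Proof. cbn. tauto. Qed.

Definition Lt (X : nat -> Prop) (i j : nat) : Prop := X (pr i j) /\ ~ X (pr j i).
Definition Linear (X : nat -> Prop) : Prop :=
  (forall i j, X (pr i j) -> X (pr i i) /\ X (pr j j)) /\
  (forall i j k, X (pr i j) /\ X (pr j k) -> X (pr i k)) /\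
  (forall i j, X (pr i j) /\ X (pr j i) -> i = j) /\
  (forall i j, X (pr i i) /\ X (pr j j) -> X (pr i j) \/ X (pr j i)).
Definition Wellfounded (M : (nat -> Prop) -> Prop) (X : nat -> Prop) : Prop :=
  ~ exM M (fun F => Real F /\
      forall n, exists u v, F (pr n u) /\ F (pr (n + 1) v) /\ Lt X v u).
Definition Below (X Y : nat -> Prop) (j : nat) (Z : nat -> Prop) : Prop :=
  forall q, Z q <-> exists m i, q = pr m i /\ Lt X i j /\ Y q.

Lemma recursion_meaning M rho sigma :
  sat M rho sigma (transfinite_recursion truth_form) ->
  forall X, M X -> Linear X /\ Wellfounded M X ->
  exM M (fun Y => forall p, Y p <->
    exists j n, p = pr n j /\ X (pr j j) /\
      exM M (fun Z => Below X Y j Z /\ Theta (sigma 0) Z n)).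
Proof.
  unfold Linear, Wellfounded, Below, Lt, Theta, Real, iff.
  sat_meaning.
Qed.

Section Recursion.
Variable M : closed_class.

Definition le_set (z : nat) : Prop := exists i j, z = pr i j /\ ~ j < i.

Lemma le_setE i j : le_set (pr i j) <-> i <= j.
Proof.
  split.
  - intros (i' & j' & E & H). apply pr_inj in E as [<- <-]. lia.
  - intros H. exists i, j. split; [reflexivity|lia].
Qed.

Lemma le_set_well_order : Linear le_set /\ Wellfounded M le_set.
Proof.
  split; [repeat split|].
  1-2: apply le_setE; auto.
  - intros i j k. rewrite !le_setE. lia.
  - intros i j. rewrite !le_setE. lia.
  - intros i j. rewrite !le_setE. lia.
  - intros (F & _ & [_ HF] & Hdesc).
    (* Strong induction on the value shows that no number occurs at any place of the descending
       sequence. *)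
    enough (H : forall u n, ~ F (pr n u)).
    { destruct (HF 0) as (u & Hu & _). exact (H u 0 Hu). }
    induction u as [u IH] using lt_wf_ind. intros n Hu.
    destruct (Hdesc n) as (u' & v & Hu' & Hv & _ & Hlt). rewrite le_setE in Hlt.
    destruct (HF n) as (x & _ & Hx). rewrite <- (Hx u Hu) in Hx.
    rewrite (Hx u' Hu') in Hlt. apply (IH v) with (n := n + 1); [lia|assumption].
Qed.

Variable Y : nat -> Prop.
Hypothesis HY : M Y.
Hypothesis Hrec : forall p, Y p <->
    exists j n, p = pr n j /\ le_set (pr j j) /\
      exM M (fun Z => Below le_set Y j Z /\ Theta W Z n).

Let columns (j q : nat) : Prop := exists m i, q = pr m i /\ i < j /\ Y q.

(** The set Y^j is [columns j]: it lies in [M] because [Y] does, and by extensionality every witness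
    [Z] equals it. *)
Lemma recursion_column n j : Y (pr n j) <-> Theta W (columns j) n.
Proof.
  assert (Hlt : forall i, Lt le_set i j <-> i < j).
  { intros i. unfold Lt. rewrite !le_setE. lia. }
  rewrite Hrec. split.
  - intros (j' & n' & E & _ & Z & _ & HZ & Hth). apply pr_inj in E as [<- <-].
    replace (columns j) with Z; [assumption|].
    apply functional_extensionality; intros q. apply propositional_extensionality.
    rewrite (HZ q). unfold columns. split; intros (m & i & H1 & H2 & H3); exists m, i;
      (split; [assumption|split; [now apply Hlt|assumption]]).
  - intros H. exists j, n. split; [reflexivity|split; [now apply le_setE|]].
    exists (columns j). split; [unfold columns; definable|split; [|assumption]].
    intros q; unfold columns. split; intros (m & i & H1 & H2 & H3); exists m, i;
      (split; [assumption|split; [now apply Hlt|assumption]]).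
Qed.

Lemma columnsE n i j : columns j (pr n i) <-> i < j /\ Y (pr n i).
Proof.
  unfold columns; split.
  - intros (m & i' & E & H). now apply pr_inj in E as [<- <-].
  - intros [H1 H2]; eauto.
Qed.

Lemma column_marker i j : columns j (pr 0 i) <-> i < j.
Proof.
  rewrite columnsE. split; [tauto|]. intros H; split; [assumption|].
  apply recursion_column. now left.
Qed.

Lemma column_elements j e : Y (pr (e + 1) j) <->
    ( (j = pr 1 0 /\ W e)
   \/ (exists i a, j = pr 2 (pr i a) /\
         exists y, W (pr 1 (pr i (pr e y))) /\ columns j (pr (y + 1) a))
   \/ (exists a b, j = pr 3 (pr a b) /\
         (columns j (pr (e + 1) a) -> columns j (pr (e + 1) b)))
   \/ (exists a, j = pr 4 a /\ forall x, columns j (pr (pr x e + 1) a))).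
Proof.
  rewrite recursion_column. split.
  - intros [H|(e' & E & j' & H1 & H2 & H)]; [lia|].
    assert (e' = e) as -> by lia.
    assert (j' = j) as ->; [|exact H].
    (* The markers present are those of the columns below [j], so the least missing one is [j]
       itself. *)
    rewrite column_marker in H2. destruct (Nat.lt_trichotomy j' j) as [Hl|[Hl|Hl]]; [lia|auto|].
    apply H1, column_marker in Hl. lia.
  - intros H. right. exists e. split; [reflexivity|]. exists j.
    split; [intros i; apply column_marker|]. split; [rewrite column_marker; lia|exact H].
Qed.

(** Subdefinitions have smaller codes, so their columns are available when the column of [x] is
    formed. *)
Lemma column_truth x : forall e, Y (pr (e + 1) (sx_code x)) <-> den x e.
Proof.
  induction x as [|f a IHa|a IHa b IHb|a IHa]; intros e; rewrite column_elements; cbn [sx_code den].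
  - split; [|auto].
    intros [[_ H]|[(i & a & E & _)|[(a & b & E & _)|(a & E & _)]]]; [assumption|..];
      apply pr_inj in E as [E _]; discriminate.
  - split.
    + intros [[E _]|[(i & c & E & y & Hy & H)|[(c & b & E & _)|(c & E & _)]]];
        apply pr_inj in E as [E1 E]; try discriminate.
      apply pr_inj in E as [<- <-]. apply W_fnE in Hy as <-. apply columnsE in H as [_ H].
      now apply IHa.
    + intros H. right; left. exists (fn_code f), (sx_code a). split; [reflexivity|].
      exists (fapp f e). split; [now apply W_fnE|]. apply columnsE. split; [|now apply IHa].
      apply (Nat.le_lt_trans _ (pr (fn_code f) (sx_code a))); [apply pr_ge_r|apply pr_gt_r; lia].
  - assert (La : sx_code a < pr 3 (pr (sx_code a) (sx_code b))).
    { apply (Nat.le_lt_trans _ (pr (sx_code a) (sx_code b))); [apply pr_ge_l|apply pr_gt_r; lia]. }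
    assert (Lb : sx_code b < pr 3 (pr (sx_code a) (sx_code b))).
    { apply (Nat.le_lt_trans _ (pr (sx_code a) (sx_code b))); [apply pr_ge_r|apply pr_gt_r; lia]. }
    rewrite <- IHa, <- IHb. split.
    + intros [[E _]|[(i & c & E & _)|[(c & d & E & H)|(c & E & _)]]];
        apply pr_inj in E as [E1 E]; try discriminate.
      apply pr_inj in E as [<- <-]. rewrite !columnsE in H. tauto.
    + intros H. right; right; left. exists (sx_code a), (sx_code b). split; [reflexivity|].
      rewrite !columnsE. tauto.
  - split.
    + intros [[E _]|[(i & c & E & _)|[(c & d & E & _)|(c & E & H)]]];
        apply pr_inj in E as [E1 E]; try discriminate.
      subst c. intros x. apply IHa. specialize (H x). now apply columnsE in H.
    + intros H. right; right; right. exists (sx_code a). split; [reflexivity|].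
      intros x. apply columnsE. split; [apply pr_gt_r; lia|now apply IHa].
Qed.

Lemma recursion_diagonal : M diagonal.
Proof.
  apply (def_ext M (fun j => W (pr 0 j) /\ ~ Y (pr (j + 1) j))); [|definable].
  intros j. rewrite W_sxE. unfold diagonal. split.
  - intros [[x <-] H]. exists x. split; [reflexivity|]. now rewrite <- column_truth.
  - intros (x & <- & H). split; [eauto|]. now rewrite column_truth.
Qed.
End Recursion.

Lemma recursion_yields_diagonal (M : closed_class) :
  valid M (transfinite_recursion truth_form) -> M diagonal.
Proof.
  (* The set parameter of [truth_form] is interpreted by [W]. *)
  intros H. specialize (H 0 (fun _ => W) (fun _ => cl_base M)).
  destruct (recursion_meaning M _ _ H le_set) as (Y & HY & Hrec).
  - unfold le_set. definable.
  - apply le_set_well_order.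
  - now apply (recursion_diagonal M Y).
Qed.

Theorem theorem5p7 : ~ proves_theory (add_axiom ACA0 wMPT) ATR0.
Proof.
  intros Hprove.
  destruct (tower_exists diagonal ground ground_countable diagonal_not_ground)
    as (K & Hdiag & HK).
  destruct (recursion_yields_diagonal (tower_union K HK)) as [i Hi]; [|now apply (Hdiag i)].
  apply (soundness_provable _ (add_axiom ACA0 wMPT)).
  - intros p [Hp| ->]; [now apply ACA0_valid|apply tower_wMPT].
  - apply Hprove, ATR0_rec, truth_form_arithmetical.
Qed.
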